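(* Let $K$ be a field, let $Q$ be a finite, connected and acyclic quiver, and let $A=KQ$ be its path algebra. Then $\mathrm{dom.dim}\,A=1$ if $Q=\vec A_n$ (for some $n\in\mathbb{N}$), and $\mathrm{dom.dim}\,A=0$ if $Q\neq\vec A_n$ (for every $n\in\mathbb{N}$), where $\vec A_n$ is linearly oriented.
   Context: $\vec A_n$ denotes the linearly oriented quiver $1\to 2\to\cdots\to n$ with vertex set $\{1,2,\dots,n\}$, $n\in\mathbb{N}$. Modules are finite dimensional left modules. For a module $M$ and $n\in\mathbb{N}$, write $\mathrm{dom.dim}\,M\ge n$ if there is a minimal injective resolution $0\to M\to I_1\to I_2\to\cdots\to I_n\to\cdots$ of $M$ such that all the modules $I_j$ with $1\le j\le n$ are projective-injective, i.e. both projective and injective (zero modules count as projective-injective). If the injective envelope $I_1$ of $M$ is not projective, set $\mathrm{dom.dim}\,M=0$; if $\mathrm{dom.dim}\,M\ge n$ but not $\mathrm{dom.dim}\,M\ge n+1$, then $\mathrm{dom.dim}\,M=n$; if no such $n$ exists, $\mathrm{dom.dim}\,M=\infty$. The dominant dimension of an algebra $A$ is that of its left regular module: $\mathrm{dom.dim}\,A:=\mathrm{dom.dim}({}_AA)$.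
   Formalization: The claim dom.dim A = 1 is stated only for Q = A_n with n ≥ 2; for n = 1, where A = K is self-injective and the original claim fails, the value is given as dom.dim A = ∞. *)

(* Defs.v *)
From HB Require Import structures.
From mathcomp Require Import all_boot all_algebra finmap.
From mathcomp Require Import boolp.
From mathcomp.multinomials Require Import monalg.

Set Implicit Arguments.
Unset Strict Implicit.
Unset Printing Implicit Defensive.

Import GRing.Theory.

Local Open Scope ring_scope.

(* Vertex sets are required to be nonempty, so that path algebras are nonzero
   rings; a connected quiver is nonempty anyway. *)
Record quiver := Quiver {
  vertex : finType;
  arrow : finType;
  src : arrow -> vertex;
  tgt : arrow -> vertex;
  vertex_gt0 : (0 < #|vertex|)%N }.

Fixpoint walk (Q : quiver) (x : vertex Q) (s : seq (arrow Q)) : bool :=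
  if s is a :: s' then (src a == x) && walk (tgt a) s' else true.

Definition walk_end (Q : quiver) (x : vertex Q) (s : seq (arrow Q)) :
  vertex Q := last x (map (@tgt Q) s).

Definition acyclic (Q : quiver) : Prop :=
  forall (x : vertex Q) (s : seq (arrow Q)),
    walk x s -> walk_end x s = x -> s = [::].

Definition adjacent (Q : quiver) : rel (vertex Q) :=
  [rel x y | [exists a : arrow Q,
     ((src a == x) && (tgt a == y)) || ((src a == y) && (tgt a == x))]].

Definition connected (Q : quiver) : Prop :=
  forall x y : vertex Q, connect (@adjacent Q) x y.

Definition quiver_iso (Q Q' : quiver) : Prop :=
  exists (f : vertex Q -> vertex Q') (g : arrow Q -> arrow Q'),
    [/\ bijective f, bijective g,
        forall a, src (g a) = f (src a) & forall a, tgt (g a) = f (tgt a)].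

Section LinearQuiver.
Variables (n : nat) (n_gt0 : (0 < n)%N).

Lemma linear_tgt_subproof (i : 'I_n.-1) : (i.+1 < n)%N.
Proof. by rewrite -ltn_predRL. Qed.

Lemma linear_vertex_subproof : (0 < #|'I_n|)%N.
Proof. by rewrite card_ord. Qed.

(* 0 -> 1 -> ... -> n - 1, the arrow i going from i to i + 1. *)
Definition linear_quiver : quiver :=
  @Quiver 'I_n 'I_n.-1 (widen_ord (leq_pred n))
    (fun i => Ordinal (linear_tgt_subproof i)) linear_vertex_subproof.

End LinearQuiver.

(* A path is a pair of its starting vertex and its sequence of arrows, the
   first arrow to be followed coming first; (x, [::]) is the path of length
   zero at x. *)
Definition qpath (Q : quiver) :=
  {p : vertex Q * seq (arrow Q) | walk p.1 p.2}.

Section Paths.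
Variable Q : quiver.
Implicit Types (x : vertex Q) (s t : seq (arrow Q)) (p q r : qpath Q).

Definition path_start p : vertex Q := (val p).1.
Definition path_end p : vertex Q := walk_end (val p).1 (val p).2.

Definition path_triv x : qpath Q :=
  exist (fun p : vertex Q * seq (arrow Q) => walk p.1 p.2) (x, [::]) isT.

(* Paths compose like functions: [path_comp p q] is q followed by p. *)
Definition path_comp p q : option (qpath Q) :=
  if path_start p == path_end q
  then insub ((val q).1, (val q).2 ++ (val p).2) : option (qpath Q)
  else None.

Lemma walk_cat x s t : walk x (s ++ t) = walk x s && walk (walk_end x s) t.
Proof.
elim: s x => [|a s IHs] x //=; rewrite IHs andbA /walk_end /=.
by case: s {IHs}.
Qed.

Lemma walk_end_cat x s t : walk_end x (s ++ t) = walk_end (walk_end x s) t.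
Proof. by rewrite /walk_end map_cat last_cat. Qed.

Variant path_comp_spec p q : option (qpath Q) -> Prop :=
| PathComp r of path_start p = path_end q & path_start r = path_start q
    & path_end r = path_end p & (val r).2 = (val q).2 ++ (val p).2 :
    path_comp_spec p q (Some r)
| PathNotComp of path_start p != path_end q : path_comp_spec p q None.

Lemma path_compP p q : path_comp_spec p q (path_comp p q).
Proof.
rewrite /path_comp; case: eqVneq => [pq|]; last by constructor.
case: insubP => [r _ rE|]; first constructor => //.
- by rewrite /path_start rE.
- by rewrite /path_end rE /= walk_end_cat -/(path_end q) -pq.
- by rewrite rE.
rewrite /= walk_cat (valP q) /= => /negP[].
by have := valP p; rewrite -/(path_end q) -pq.
Qed.

Lemma path_eq p q :
  path_start p = path_start q -> (val p).2 = (val q).2 -> p = q.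
Proof.
move=> e1 e2; apply: val_inj; move: e1 e2; rewrite /path_start.
by case: (val p) (val q) => [? ?] [? ?] /= -> ->.
Qed.

Lemma path_compA p q r :
  obind (path_comp p) (path_comp q r) = obind (path_comp^~ r) (path_comp p q).
Proof.
case: (path_compP q r) => [qr e1 s1 t1 a1|ne1] /=;
  case: (path_compP p q) => [pq e2 s2 t2 a2|ne2] //=.
- case: (path_compP p qr) => [u e3 s3 t3 a3|]; last by rewrite t1 e2 eqxx.
  case: (path_compP pq r) => [v e4 s4 t4 a4|]; last by rewrite s2 e1 eqxx.
  by congr Some; apply: path_eq; rewrite ?s3 ?s4 // a3 a4 a1 a2 catA.
- by case: (path_compP p qr) => // u e3; rewrite -t1 -e3 eqxx in ne2.
- by case: (path_compP pq r) => // v e4; rewrite -s2 e4 eqxx in ne1.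
Qed.

Lemma path_comp_trivl x p :
  path_comp (path_triv x) p = if x == path_end p then Some p else None.
Proof.
case: path_compP => [r e s t a|/negPf].
  rewrite -[x]/(path_start (path_triv x)) e eqxx.
  by congr Some; apply: path_eq; rewrite // a cats0.
by rewrite -[path_start (path_triv x)]/x => ->.
Qed.

Lemma path_comp_trivr x p :
  path_comp p (path_triv x) = if x == path_start p then Some p else None.
Proof.
case: path_compP => [r e s t a|/negPf].
  rewrite -[x]/(path_end (path_triv x)) -e eqxx.
  by congr Some; apply: path_eq; rewrite // s e.
by rewrite -[path_end (path_triv x)]/x eq_sym => ->.
Qed.

End Paths.

(* The vector space on the set of paths.  Its operations are locked because
   unification otherwise unfolds the finitely supported functions. *)
Record path_algebra (K : fieldType) (Q : quiver) :=
  PathAlgebra { pa_val : {malg K[qpath Q]} }.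

HB.instance Definition _ (K : fieldType) (Q : quiver) :=
  [isNew for @pa_val K Q].
HB.instance Definition _ (K : fieldType) (Q : quiver) :=
  [Choice of path_algebra K Q by <:].

HB.lock Definition pa_coef (K : fieldType) (Q : quiver)
  (f : path_algebra K Q) (p : qpath Q) : K := (pa_val f)@_p.
HB.lock Definition pa_supp (K : fieldType) (Q : quiver)
  (f : path_algebra K Q) : {fset qpath Q} := msupp (pa_val f).
HB.lock Definition pa_zero (K : fieldType) (Q : quiver) : path_algebra K Q :=
  PathAlgebra 0.
HB.lock Definition pa_opp (K : fieldType) (Q : quiver)
  (f : path_algebra K Q) : path_algebra K Q := PathAlgebra (- pa_val f).
HB.lock Definition pa_add (K : fieldType) (Q : quiver)
  (f g : path_algebra K Q) : path_algebra K Q :=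
  PathAlgebra (pa_val f + pa_val g).
HB.lock Definition pa_scale (K : fieldType) (Q : quiver) (c : K)
  (f : path_algebra K Q) : path_algebra K Q := PathAlgebra (c *: pa_val f).
HB.lock Definition path_basis (K : fieldType) (Q : quiver) (p : qpath Q) :
  path_algebra K Q := PathAlgebra << p >>.

Section PathSpace.
Variables (K : fieldType) (Q : quiver).
Local Notation A := (path_algebra K Q).
Implicit Types (f g h : A) (p q r : qpath Q).

Lemma pa_coefP f g : (forall p, pa_coef f p = pa_coef g p) -> f = g.
Proof.
by rewrite unlock => fg; apply: val_inj; apply/malgP; exact: fg.
Qed.

Lemma pa_suppE f p : (p \in pa_supp f) = (pa_coef f p != 0).
Proof. by rewrite !unlock mcoeff_neq0. Qed.

Lemma pa_coef_zero p : pa_coef (pa_zero K Q) p = 0.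
Proof. by rewrite !unlock; exact: mcoeff0. Qed.

Lemma pa_coef_opp f p : pa_coef (pa_opp f) p = - pa_coef f p.
Proof. by rewrite !unlock; exact: mcoeffN. Qed.

Lemma pa_coef_add f g p : pa_coef (pa_add f g) p = pa_coef f p + pa_coef g p.
Proof. by rewrite !unlock; exact: mcoeffD. Qed.

Lemma pa_coef_scale c f p : pa_coef (pa_scale c f) p = c * pa_coef f p.
Proof. by rewrite !unlock; exact: mcoeffZ. Qed.

Lemma pa_coef_basis p q : pa_coef (path_basis K p) q = (p == q)%:R.
Proof. by rewrite !unlock; exact: mcoeffU. Qed.

Let coefE :=
  (pa_coef_zero, pa_coef_opp, pa_coef_add, pa_coef_scale, pa_coef_basis).

Lemma pa_addA : associative (@pa_add K Q).
Proof. by move=> f g h; apply: pa_coefP => p; rewrite !coefE addrA. Qed.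

Lemma pa_addC : commutative (@pa_add K Q).
Proof. by move=> f g; apply: pa_coefP => p; rewrite !coefE addrC. Qed.

Lemma pa_add0 : left_id (pa_zero K Q) (@pa_add K Q).
Proof. by move=> f; apply: pa_coefP => p; rewrite !coefE add0r. Qed.

Lemma pa_addN : left_inverse (pa_zero K Q) (@pa_opp K Q) (@pa_add K Q).
Proof. by move=> f; apply: pa_coefP => p; rewrite !coefE addNr. Qed.

HB.instance Definition _ := GRing.isZmodule.Build A
  pa_addA pa_addC pa_add0 pa_addN.

Lemma pa_scaleA c d f : pa_scale c (pa_scale d f) = pa_scale (c * d) f.
Proof. by apply: pa_coefP => p; rewrite !coefE mulrA. Qed.

Lemma pa_scale1 : left_id 1 (@pa_scale K Q).
Proof. by move=> f; apply: pa_coefP => p; rewrite !coefE mul1r. Qed.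

Lemma pa_scaleDr : right_distributive (@pa_scale K Q) +%R.
Proof. by move=> c f g; apply: pa_coefP => p; rewrite !coefE mulrDr. Qed.

Lemma pa_scaleDl f : {morph (@pa_scale K Q)^~ f : c d / c + d}.
Proof. by move=> c d; apply: pa_coefP => p; rewrite !coefE mulrDl. Qed.

HB.instance Definition _ := GRing.Zmodule_isLmodule.Build K A
  pa_scaleA pa_scale1 pa_scaleDr pa_scaleDl.

Lemma pa_coefD f g p : pa_coef (f + g) p = pa_coef f p + pa_coef g p.
Proof. exact: pa_coef_add. Qed.

Lemma pa_coefZ c f p : pa_coef (c *: f) p = c * pa_coef f p.
Proof. exact: pa_coef_scale. Qed.

Lemma pa_coef0 p : pa_coef (0 : A) p = 0.
Proof. exact: pa_coef_zero. Qed.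

Lemma pa_coef_sum I (s : seq I) (P : pred I) (F : I -> A) p :
  pa_coef (\sum_(i <- s | P i) F i) p = \sum_(i <- s | P i) pa_coef (F i) p.
Proof.
exact: (big_morph (fun f => pa_coef f p) (fun f g => pa_coefD f g p)
  (pa_coef0 p)).
Qed.

Lemma pa_supp_notin f p : p \notin pa_supp f -> pa_coef f p = 0.
Proof. by rewrite pa_suppE negbK => /eqP. Qed.

Lemma path_basisE f :
  f = \sum_(p <- pa_supp f) pa_coef f p *: path_basis K p.
Proof.
apply: pa_coefP => q; rewrite pa_coef_sum.
have [qf|qf] := boolP (q \in pa_supp f).
  rewrite (big_fsetD1 q) //= pa_coefZ pa_coef_basis eqxx mulr1.
  rewrite big1_fset ?addr0 // => p; rewrite in_fsetD1 => /andP[/negPf pq _] _.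
  by rewrite pa_coefZ pa_coef_basis pq mulr0.
rewrite pa_supp_notin // big1_fset // => p pf _.
rewrite pa_coefZ pa_coef_basis; case: eqP qf pf => [->|]; last by rewrite mulr0.
by move=> /negPf ->.
Qed.

Lemma pa_supp_basis p : pa_supp (path_basis K p) = [fset p]%fset.
Proof.
apply/fsetP => q; rewrite pa_suppE pa_coef_basis in_fset1 [RHS]eq_sym.
by case: (p == q); rewrite ?oner_eq0 ?eqxx.
Qed.

Definition path_mul p q : A := oapp (@path_basis K Q) 0 (path_comp p q).

End PathSpace.

HB.lock Definition pa_one (K : fieldType) (Q : quiver) : path_algebra K Q :=
  \sum_(x : vertex Q) path_basis K (path_triv x).

HB.lock Definition pa_mul (K : fieldType) (Q : quiver)
  (f g : path_algebra K Q) : path_algebra K Q :=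
  \sum_(p <- pa_supp f) \sum_(q <- pa_supp g)
    (pa_coef f p * pa_coef g q) *: path_mul K p q.

Section PathAlgebra.
Variables (K : fieldType) (Q : quiver).
Local Notation A := (path_algebra K Q).
Implicit Types (f g h : A) (p q r : qpath Q).

Lemma pa_mulEw (d e : {fset qpath Q}) f g :
    (pa_supp f `<=` d)%fset -> (pa_supp g `<=` e)%fset ->
  pa_mul f g = \sum_(p <- d) \sum_(q <- e)
    (pa_coef f p * pa_coef g q) *: path_mul K p q.
Proof.
move=> sd se; rewrite pa_mul.unlock (big_fset_incl _ sd); last first.
  by move=> p _ /pa_supp_notin ->; rewrite big1 // => q _; rewrite mul0r scale0r.
apply: eq_bigr => p _; apply: big_fset_incl => // q _ /pa_supp_notin ->.
by rewrite mulr0 scale0r.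
Qed.

Lemma pa_mul_linearl g : linear ((@pa_mul K Q)^~ g).
Proof.
move=> c f f'.
pose d := (pa_supp f `|` pa_supp f' `|` pa_supp (c *: f + f')%R)%fset.
have s1 : (pa_supp (c *: f + f')%R `<=` d)%fset by rewrite fsubsetUr.
have s2 : (pa_supp f `<=` d)%fset by rewrite /d -fsetUA fsubsetUl.
have s3 : (pa_supp f' `<=` d)%fset by rewrite /d fsetUAC fsubsetUr.
have se : (pa_supp g `<=` pa_supp g)%fset by [].
rewrite (pa_mulEw s1 se) (pa_mulEw s2 se) (pa_mulEw s3 se).
rewrite scaler_sumr -big_split; apply: eq_bigr => p _ /=.
rewrite scaler_sumr -big_split; apply: eq_bigr => q _ /=.
by rewrite pa_coefD pa_coefZ mulrDl scalerDl scalerA mulrA.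
Qed.

Lemma pa_mul_linearr f : linear (@pa_mul K Q f).
Proof.
move=> c g g'.
pose d := (pa_supp g `|` pa_supp g' `|` pa_supp (c *: g + g')%R)%fset.
have s1 : (pa_supp (c *: g + g')%R `<=` d)%fset by rewrite fsubsetUr.
have s2 : (pa_supp g `<=` d)%fset by rewrite /d -fsetUA fsubsetUl.
have s3 : (pa_supp g' `<=` d)%fset by rewrite /d fsetUAC fsubsetUr.
have se : (pa_supp f `<=` pa_supp f)%fset by [].
rewrite (pa_mulEw se s1) (pa_mulEw se s2) (pa_mulEw se s3).
rewrite scaler_sumr -big_split; apply: eq_bigr => p _ /=.
rewrite scaler_sumr -big_split; apply: eq_bigr => q _ /=.
by rewrite pa_coefD pa_coefZ mulrDr scalerDl scalerA mulrCA.
Qed.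

Lemma pa_mulDr : right_distributive (@pa_mul K Q) +%R.
Proof. by move=> f g h; have := pa_mul_linearr f 1 g h; rewrite !scale1r. Qed.

Lemma pa_mul0 f : pa_mul f 0 = 0.
Proof. by apply: (addrI (pa_mul f 0)); rewrite -pa_mulDr !addr0. Qed.

Lemma pa_mulZr c f g : c *: pa_mul f g = pa_mul f (c *: g).
Proof. by have := pa_mul_linearr f c g 0; rewrite pa_mul0 !addr0. Qed.

Lemma pa_mulDl : left_distributive (@pa_mul K Q) +%R.
Proof. by move=> f g h; have := pa_mul_linearl h 1 f g; rewrite !scale1r. Qed.

Lemma pa_0mul f : pa_mul 0 f = 0.
Proof. by apply: (addrI (pa_mul 0 f)); rewrite -pa_mulDl !addr0. Qed.

Lemma pa_mulZl c f g : c *: pa_mul f g = pa_mul (c *: f) g.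
Proof. by have := pa_mul_linearl g c f 0; rewrite pa_0mul !addr0. Qed.

Lemma pa_mul_suml I (s : seq I) (P : pred I) (F : I -> A) g :
  pa_mul (\sum_(i <- s | P i) F i) g = \sum_(i <- s | P i) pa_mul (F i) g.
Proof.
apply: (big_morph ((@pa_mul K Q)^~ g) _ (pa_0mul g)) => f f'; exact: pa_mulDl.
Qed.

Lemma pa_mul_sumr I (s : seq I) (P : pred I) (F : I -> A) f :
  pa_mul f (\sum_(i <- s | P i) F i) = \sum_(i <- s | P i) pa_mul f (F i).
Proof. exact: (big_morph (@pa_mul K Q f) (pa_mulDr f) (pa_mul0 f)). Qed.

Lemma pa_mul_basis p q :
  pa_mul (path_basis K p) (path_basis K q) = path_mul K p q.
Proof.
rewrite pa_mul.unlock !pa_supp_basis !big_seq_fset1.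
by rewrite !pa_coef_basis !eqxx mulr1 scale1r.
Qed.

Lemma pa_mulA : associative (@pa_mul K Q).
Proof.
move=> f g h.
rewrite [f]path_basisE !pa_mul_suml; apply: eq_bigr => p _.
rewrite -!pa_mulZl; congr (_ *: _).
rewrite [g]path_basisE !pa_mul_suml !pa_mul_sumr pa_mul_suml.
apply: eq_bigr => q _; rewrite -pa_mulZl -!pa_mulZr -pa_mulZl; congr (_ *: _).
rewrite [h]path_basisE !pa_mul_sumr; apply: eq_bigr => r _.
rewrite -!pa_mulZr; congr (_ *: _); rewrite !pa_mul_basis /path_mul.
have := path_compA p q r.
case: (path_comp q r) (path_comp p q) => [u|] [v|] //= e;
  rewrite ?pa_mul0 ?pa_0mul ?pa_mul_basis /path_mul //.
- by rewrite e.
- by rewrite e.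
- by rewrite -e.
Qed.

Lemma pa_mul1 : left_id (pa_one K Q) (@pa_mul K Q).
Proof.
move=> f; rewrite [f]path_basisE pa_mul_sumr; apply: eq_bigr => p _.
rewrite -pa_mulZr; congr (_ *: _); rewrite pa_one.unlock pa_mul_suml.
rewrite (bigD1 (path_end p)) //= big1 ?addr0 => [|x /negPf ne];
  by rewrite pa_mul_basis /path_mul path_comp_trivl ?eqxx ?ne.
Qed.

Lemma pa_mulr1 : right_id (pa_one K Q) (@pa_mul K Q).
Proof.
move=> f; rewrite [f]path_basisE pa_mul_suml; apply: eq_bigr => p _.
rewrite -pa_mulZl; congr (_ *: _); rewrite pa_one.unlock pa_mul_sumr.
rewrite (bigD1 (path_start p)) //= big1 ?addr0 => [|x /negPf ne];
  by rewrite pa_mul_basis /path_mul path_comp_trivr ?eqxx ?ne.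
Qed.

Lemma pa_one_neq0 : pa_one K Q != 0.
Proof.
have /card_gt0P [x _] := vertex_gt0 Q.
apply/eqP => /(congr1 (fun f => pa_coef f (path_triv x))) /eqP.
rewrite pa_coef0 pa_one.unlock pa_coef_sum (bigD1 x) //=.
rewrite pa_coef_basis eqxx big1 ?addr0 ?oner_eq0 // => y ne.
by rewrite pa_coef_basis; case: eqP => // - [e]; rewrite e eqxx in ne.
Qed.

HB.instance Definition _ := GRing.Zmodule_isNzRing.Build A
  pa_mulA pa_mul1 pa_mulr1 pa_mulDl pa_mulDr pa_one_neq0.
HB.instance Definition _ := GRing.Lmodule_isLalgebra.Build K A pa_mulZl.
HB.instance Definition _ := GRing.Lalgebra_isAlgebra.Build K A pa_mulZr.

End PathAlgebra.

Section Modules.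
Variables (K : fieldType) (A : algType K).
Implicit Types M N I P : lmodType A.

(* K acts on a left A-module through K -> A, c |-> c%:A. *)
Definition fin_dim M : Prop :=
  exists s : seq M, forall v : M, exists c : 'I_(size s) -> K,
    v = \sum_(i < size s) (c i)%:A *: s`_i.

Definition surjective_hom M N (f : {linear M -> N}) : Prop :=
  forall y : N, exists x : M, f x = y.

(* Projectivity and injectivity are taken in the category of finite
   dimensional left A-modules. *)
Definition projective_module P : Prop :=
  fin_dim P /\
  forall (X Y : lmodType A) (g : {linear X -> Y}) (f : {linear P -> Y}),
    fin_dim X -> fin_dim Y -> surjective_hom g ->
    exists h : {linear P -> X}, forall x, g (h x) = f x.

Definition injective_module I : Prop :=
  fin_dim I /\
  forall (X Y : lmodType A) (g : {linear X -> Y}) (f : {linear X -> I}),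
    fin_dim X -> fin_dim Y -> injective g ->
    exists h : {linear Y -> I}, forall x, h (g x) = f x.

Definition projective_injective M : Prop :=
  projective_module M /\ injective_module M.

(* The image of f is an essential submodule: it meets every nonzero submodule
   nontrivially. *)
Definition essential_image M N (f : {linear M -> N}) : Prop :=
  forall U : {pred N}, submod_closed U -> (exists2 u : N, u \in U & u != 0) ->
    exists m : M, (f m \in U) && (f m != 0).

Definition injective_envelope M I (i : {linear M -> I}) : Prop :=
  [/\ injective_module I, injective i & essential_image i].

(* 0 -> M -> I_1 -> I_2 -> ..., where [mir_term j] is I_(j+1).  Minimality says
   that I_(j+2) is an injective envelope of the image of I_(j+1) -> I_(j+2). *)
Record min_inj_resolution M := MinInjResolution {
  mir_term : nat -> lmodType A;
  mir_aug : {linear M -> mir_term 0%N};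
  mir_diff : forall j, {linear mir_term j -> mir_term j.+1};
  mir_injective : forall j, injective_module (mir_term j);
  mir_aug_inj : injective mir_aug;
  mir_exact0 : forall x, mir_diff 0 x = 0 <-> exists m, mir_aug m = x;
  mir_exactS : forall j x,
    mir_diff j.+1 x = 0 <-> exists y, mir_diff j y = x;
  mir_aug_essential : essential_image mir_aug;
  mir_diff_essential : forall j, essential_image (mir_diff j) }.

Definition dom_dim_ge M (n : nat) : Prop :=
  exists R : min_inj_resolution M,
    forall j, (j < n)%N -> projective_injective (mir_term R j).

Definition nonprojective_envelope M : Prop :=
  exists (I : lmodType A) (i : {linear M -> I}),
    injective_envelope i /\ ~ projective_module I.

(* [None] stands for infinity. *)
Definition dom_dim M : option nat :=
  if pselect (nonprojective_envelope M) then Some 0%N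
  else match pselect (exists n, [/\ (0 < n)%N, dom_dim_ge M n
                                  & ~ dom_dim_ge M n.+1]) with
       | left h => Some (projT1 (cid h))
       | right _ => None
       end.

End Modules.

Definition dom_dim_alg (K : fieldType) (A : algType K) : option nat :=
  dom_dim (A^o : lmodType A).

(* Main.v *)
From HB Require Import structures.
Require Import Defs.
From mathcomp Require Import all_boot all_algebra.
From mathcomp Require Import boolp.

(** A left module over [A = KQ] is a representation of [Q], and two conditions
    on it, dual to each other, decide the matter.  If, at every vertex [x], the
    arrows leaving [x] map [M_x] onto the product of the spaces at their
    targets, then [M] is injective ([out_surjective_injective]).  If [M] is
    projective, then the arrows entering each vertex are jointly injective
    ([projective_in_independent]).  The first condition is inherited by
    quotients, which reflects that [A] is hereditary.

    The socle of [A] is spanned by the paths that end at a sink.  Hence the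
    injective envelope of [A] is the sum, over all such paths [q], of the dual
    of [e_y A], where [y] is the end of [q].  Concretely it is the space
    [socle_dual] of functions [f] of two paths [p] and [q] with a common end at
    a sink, [A] acting by [(u f)(p, q) = f(p u, q)]; an element [u] of [A] is
    sent to the function whose value at [(p, q)] is the coefficient of [q] in
    [p u] ([sd_embed_envelope]).

    Suppose that this envelope [E] is projective.  Then both conditions hold for
    [E], and [E_x] is nonzero for every vertex [x]; so two arrows can share
    neither their source nor their target ([module_out_simple],
    [module_in_simple]).  A longest walk then exhausts the connected quiver [Q],
    which is therefore linearly oriented ([simple_linear]).  Since injective
    envelopes are unique, this settles the case of dominant dimension [0].

    Conversely, if [Q] is linearly oriented, then [E] is a direct sum of copies
    of the projective module of paths from the source ([socle_dual_projective]),
    and [0 -> A -> E -> C -> 0], with [C] the cokernel, is a minimal injective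
    resolution, unique up to isomorphism ([two_term_projective]).  If its last
    term [C] were projective, [A] would be a direct summand of [E]; as it is
    essential in [E], the embedding would be onto ([projective_cokernel]).  It
    is onto precisely when [Q] has no arrow ([sd_embed_surjective]): then the
    resolution stops at [E], and the dominant dimension is infinite; otherwise
    it is [1]. *)

Set Implicit Arguments.
Unset Strict Implicit.
Unset Printing Implicit Defensive.

Import GRing.Theory.

Local Open Scope ring_scope.

(** * Walks in acyclic quivers *)

Section Walks.
Variable Q : quiver.
Implicit Types (x y : vertex Q) (s t : seq (arrow Q)) (p q : qpath Q).

Definition path_of x s (ws : walk x s) : qpath Q :=
  exist (fun p : vertex Q * seq (arrow Q) => walk p.1 p.2) (x, s) ws.

Definition walk_support x s : seq (vertex Q) := x :: map (@tgt Q) s.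

Definition out_simple := forall a b : arrow Q, src a = src b -> a = b.

Definition in_simple := forall a b : arrow Q, tgt a = tgt b -> a = b.

(** Where at most one arrow leaves each vertex, two walks can part only if one
    of them stops, and a walk that ends at a sink stops as late as possible. *)
Lemma out_simple_walk x s t :
    out_simple -> walk x s -> walk x t ->
    (forall a, src a != walk_end x s) -> (forall a, src a != walk_end x t) ->
  s = t.
Proof.
move=> outQ; elim: s x t => [|a s IHs] x [|b t] //=.
- by move=> _ /andP[bx _] /(_ b); rewrite bx.
- by move=> /andP[ax _] _ _ /(_ a); rewrite ax.
move=> /andP[/eqP ax ws] /andP[/eqP bx wt] es et.
have ab : a = b by apply: outQ; rewrite ax.
by subst b; rewrite (IHs _ t ws wt).
Qed.

Lemma walk_rconsP x s a :
  walk x (rcons s a) = walk x s && (src a == walk_end x s).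
Proof. by rewrite -cats1 walk_cat /= andbT. Qed.

Lemma walk_end_rcons x s a : walk_end x (rcons s a) = tgt a.
Proof. by rewrite /walk_end map_rcons last_rcons. Qed.

Hypothesis acQ : acyclic Q.

(** A vertex met twice would cut out a closed walk. *)
Lemma walk_support_uniq x s : walk x s -> uniq (walk_support x s).
Proof.
elim: s x => [|a s IHs] x //= /andP[/eqP ax ws].
rewrite [X in _ && X](IHs _ ws) andbT; apply/negP => xin.
have [s1 [s2 [sE end1]]] :
    exists s1 s2, s = s1 ++ s2 /\ walk_end (tgt a) s1 = x.
  move: xin; rewrite inE => /orP[/eqP -> |]; first by exists [::], s.
  case/mapP => b bs ->; case/splitPr: bs => s1 s2.
  by exists (rcons s1 b), s2; rewrite cat_rcons walk_end_rcons.
have : a :: s1 = [::].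
  apply: (acQ (x := x)); last by rewrite -[RHS]end1.
  by rewrite /= ax eqxx /=; move: ws; rewrite sE walk_cat => /andP[].
by [].
Qed.

Lemma walk_size x s : walk x s -> (size s < #|vertex Q|)%N.
Proof.
move=> ws; have /card_uniqP := walk_support_uniq ws.
by rewrite /= size_map => <-; exact: max_card.
Qed.

Lemma walk_to_sink x :
  exists2 s, walk x s & forall a, src a != walk_end x s.
Proof.
pose P l := [exists t : l.-tuple (arrow Q), walk x t].
have exP : exists l, P l by exists 0%N; apply/existsP; exists [tuple].
have ubP l : P l -> (l <= #|vertex Q|)%N.
  by case/existsP => t /walk_size /ltnW; rewrite size_tuple.
case: (ex_maxnP exP ubP) => l /existsP[t wt] maxl.
exists t => // a; apply/negP => sa.
suff /maxl : P l.+1 by rewrite ltnn.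
by apply/existsP; exists [tuple of rcons t a]; rewrite walk_rconsP wt.
Qed.

Lemma longest_walk :
  exists x s, walk x s /\
    forall y t, walk y t -> (size t <= size s)%N.
Proof.
pose P l := [exists x, exists t : l.-tuple (arrow Q), walk x t].
have exP : exists l, P l.
  have /card_gt0P [x _] := vertex_gt0 Q.
  by exists 0%N; apply/existsP; exists x; apply/existsP; exists [tuple].
have ubP l : P l -> (l <= #|vertex Q|)%N.
  by case/existsP => x /existsP[t /walk_size /ltnW]; rewrite size_tuple.
case: (ex_maxnP exP ubP) => l /existsP[x /existsP[t wt]] maxl.
exists x, t; split => // y u wu; rewrite size_tuple maxl //.
by apply/existsP; exists y; apply/existsP; exists (in_tuple u).
Qed.

(** In an acyclic quiver the bound on the length excludes no path, by
    [walk_size]. *)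
Definition all_paths : seq (qpath Q) :=
  undup (pmap insub
    [seq (x, bseqval u) | x <- enum (vertex Q),
                          u <- enum {bseq #|vertex Q| of arrow Q}]).

Lemma all_paths_uniq : uniq all_paths.
Proof. exact: undup_uniq. Qed.

Lemma mem_all_paths p : p \in all_paths.
Proof.
rewrite mem_undup mem_pmap; apply/mapP; exists (val p); last by rewrite valK.
have sz : (size (val p).2 <= #|vertex Q|)%N.
  by rewrite ltnW // (walk_size (valP p)).
apply/allpairsP; exists ((val p).1, Bseq sz).
by rewrite !mem_enum; split=> //=; apply: surjective_pairing.
Qed.

Hypotheses (connQ : connected Q) (outQ : out_simple) (inQ : in_simple).

(** A longest walk [s] cannot be prolonged at either end, so by simplicity
    every arrow that touches one of its vertices belongs to it; connectedness
    does the rest. *)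
Lemma spanning_walk :
  exists x s, [/\ walk x s, walk_support x s =i predT & s =i predT].
Proof.
have [o [s [ws maxs]]] := longest_walk.
have srcs y a : src a = y -> y \in walk_support o s -> a \in s.
  move=> ay yin; have [s1 [s2 [sE end1]]] :
      exists s1 s2, s = s1 ++ s2 /\ walk_end o s1 = y.
    move: yin; rewrite inE => /orP[/eqP -> |]; first by exists [::], s.
    case/mapP => b bs ->; case/splitPr: bs => s1 s2.
    by exists (rcons s1 b), s2; rewrite cat_rcons walk_end_rcons.
  case: s2 sE => [|b s2] sE; last first.
    move: ws; rewrite sE walk_cat /= => /and3P[_ /eqP bE _].
    by rewrite (outQ (a := a) (b := b)) ?bE ?end1 // mem_cat mem_head orbT.
  have /maxs : walk o (rcons s a).
    by rewrite walk_rconsP ws /= ay -end1 sE cats0.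
  by rewrite size_rcons ltnn.
have tgts y a : tgt a = y -> y \in walk_support o s -> a \in s.
  move=> ay; rewrite inE => /orP[/eqP yo|/mapP[b bs yb]].
    have /maxs : walk (src a) (a :: s) by rewrite /= eqxx ay yo.
    by rewrite /= ltnn.
  by rewrite (inQ (a := a) (b := b)) // ay.
have srcin a : a \in s -> src a \in walk_support o s.
  move=> /splitPr as_; case: as_ ws => s1 s2.
  rewrite walk_cat /= => /and3P[_ /eqP -> _].
  rewrite /walk_support map_cat /walk_end; case/lastP: s1 => [|s1 b] /=.
    exact: mem_head.
  by rewrite map_rcons last_rcons inE mem_cat mem_rcons mem_head orbT.
have tgtin a : a \in s -> tgt a \in walk_support o s.
  by move=> as_; rewrite inE map_f ?orbT.
have supp y : y \in walk_support o s.
  have cl : closed (@adjacent Q) (mem (walk_support o s)).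
    apply: intro_closed => [|u v].
      by move=> u v; rewrite !connQ.
    case/existsP => a /orP[] /andP[/eqP <- /eqP <-] uin.
      by apply: tgtin; apply: srcs uin.
    by apply: srcin; apply: tgts uin.
  by rewrite -[y \in _](closed_connect cl (connQ o y)) inE eqxx.
by exists o, s; split=> // a; rewrite (srcs (src a)).
Qed.

End Walks.

(** * Linearly oriented quivers *)

Section Linear.
Variable Q : quiver.
Implicit Types (x y : vertex Q) (s t : seq (arrow Q)).

Lemma linear_simple n (n_gt0 : (0 < n)%N) :
  quiver_iso Q (linear_quiver n_gt0) -> out_simple Q /\ in_simple Q.
Proof.
case=> f [g [_ bg srcg tgtg]]; split=> a b ab; apply: (bij_inj bg).
  by apply: val_inj; have := srcg a; rewrite ab -srcg => /(congr1 val).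
by apply: val_inj; have := tgtg a; rewrite ab -tgtg => /(congr1 val) [].
Qed.

Lemma linear_arrow n (n_gt0 : (0 < n)%N) :
  quiver_iso Q (linear_quiver n_gt0) -> (0 < #|arrow Q|)%N = (1 < n)%N.
Proof.
case=> f [g [_ bg _ _]]; rewrite (bij_eq_card bg) card_ord.
by rewrite -ltn_predRL.
Qed.

Lemma nth_walk_src x s a :
    walk x s -> a \in s -> nth x (walk_support x s) (index a s) = src a.
Proof.
elim: s x => [|b s IHs] x //= /andP[/eqP bx ws].
rewrite inE eq_sym; case: eqVneq => [<- _|_ as_] //=.
rewrite -(IHs (tgt b)) //; apply: (@set_nth_default _ (walk_support (tgt b) s)).
by rewrite /= size_map ltnS ltnW ?index_mem.
Qed.

Hypothesis acQ : acyclic Q.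

(** Read backwards from their common end, the two walks take the same arrows;
    if one of them stopped first, the rest of the other would be a cycle. *)
Lemma in_simple_walk x s t :
    in_simple Q -> walk x s -> walk x t -> walk_end x s = walk_end x t ->
  s = t.
Proof.
move=> inQ; elim/last_ind: s t => [|s a IHs] t ws.
  by move=> wt /esym e; rewrite (acQ wt e).
case/lastP: t => [wt e|t b]; first exact: acQ ws e.
move: ws; rewrite !walk_rconsP !walk_end_rcons => /andP[ws /eqP sa].
move=> /andP[wt /eqP sb] /inQ ab; subst b.
by rewrite (IHs t) // -sa -sb.
Qed.

Hypothesis connQ : connected Q.

Lemma root_walk :
    out_simple Q -> in_simple Q ->
  exists o, forall x, exists2 s, walk o s & walk_end o s = x.
Proof.
move=> outQ inQ; have [o [s [ws sv _]]] := spanning_walk acQ connQ outQ inQ.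
exists o => x; have := sv x; rewrite !inE => /orP[/eqP ->|].
  by exists [::].
case/mapP => a as_ ->; case/splitPr: as_ ws => s1 s2.
rewrite -cat_rcons walk_cat => /andP[ws1 _].
by exists (rcons s1 a); rewrite ?walk_end_rcons.
Qed.

(** The isomorphism sends vertices and arrows to their positions along a walk
    that passes through all of them. *)
Lemma simple_linear :
    out_simple Q -> in_simple Q ->
  exists n (n_gt0 : (0 < n)%N), quiver_iso Q (linear_quiver n_gt0).
Proof.
move=> outQ inQ; have [o [s [ws sv sa]]] := spanning_walk acQ connQ outQ inQ.
have uv := walk_support_uniq acQ ws.
have ua : uniq s by move: uv => /= /andP[_ /map_uniq].
have szv : size (walk_support o s) = (size s).+1 by rewrite /= size_map.
have fP x : (index x (walk_support o s) < (size s).+1)%N.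
  by rewrite -szv index_mem sv.
have gP a : (index a s < (size s).+1.-1)%N by rewrite index_mem sa.
exists (size s).+1, (ltn0Sn _).
exists (fun x => Ordinal (fP x)), (fun a => Ordinal (gP a)); split.
- apply: inj_card_bij => [x y|].
    move=> /(congr1 val) /(congr1 (nth o (walk_support o s))) /=.
    by rewrite !nth_index ?sv.
  by rewrite card_ord -szv -(card_uniqP uv) max_card.
- apply: inj_card_bij => [a b|].
    move=> /(congr1 val) /(congr1 (nth a s)) /=.
    by rewrite !nth_index ?sa.
  by rewrite card_ord /= -(card_uniqP ua) max_card.
- move=> a; apply: val_inj.
  change (index a s = index (src a) (walk_support o s)).
  rewrite -(nth_walk_src ws (sa a)) [RHS]index_uniq //.
  by rewrite szv ltnS ltnW ?index_mem ?sa.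
- move=> a; apply: val_inj.
  change ((index a s).+1 = index (tgt a) (walk_support o s)).
  have -> : tgt a = nth o (walk_support o s) (index a s).+1.
    by rewrite /= (nth_map a) ?nth_index ?index_mem ?sa.
  by rewrite index_uniq // szv ltnS index_mem sa.
Qed.


End Linear.

(** * Injective envelopes and minimal injective resolutions *)

Section ModuleTheory.
Variables (K : fieldType) (A : algType K).
Implicit Types M N I P : lmodType A.

Lemma fin_dim_family M (J : finType) (b : J -> M) :
    (forall v, exists c : J -> K, v = \sum_j (c j)%:A *: b j) ->
  fin_dim M.
Proof.
move=> spanb; exists (codom b) => v; have [c ->] := spanb v.
have sz : size (codom b) = #|J| by rewrite size_codom.
exists (fun i => c (enum_val (cast_ord sz i))).
rewrite (reindex_onto (fun i => enum_val (cast_ord sz i))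
          (fun j => cast_ord (esym sz) (enum_rank j))) /=; last first.
  by move=> j _; rewrite cast_ordKV enum_rankK.
rewrite (eq_bigl predT) => [|i]; last first.
  by rewrite enum_valK cast_ordK eqxx.
apply: eq_bigr => i _; congr (_ *: _); rewrite /codom /image_mem.
rewrite (nth_map (enum_val (cast_ord sz i))) -?cardE -?sz //.
by rewrite -(enum_val_nth _ (cast_ord sz i)).
Qed.

Lemma fin_dim_surj M N (f : {linear M -> N}) :
  surjective_hom f -> fin_dim M -> fin_dim N.
Proof.
move=> surjf [s spans].
apply: (@fin_dim_family _ _ (fun i => f (tnth (in_tuple s) i))).
move=> w; have [v <-] := surjf w; have [c ->] := spans v.
exists c; rewrite linear_sum; apply: eq_bigr => i _.
by rewrite linearZ (tnth_nth 0).
Qed.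

Lemma projective_retract P N (f : {linear P -> N}) (g : {linear N -> P}) :
  cancel g f -> projective_module P -> projective_module N.
Proof.
move=> gK [fdP liftP]; split.
  by apply: fin_dim_surj fdP => y; exists (g y).
move=> X Y p q fdX fdY surjp.
have [h hE] := liftP X Y p (q \o f) fdX fdY surjp.
by exists (h \o g) => x; rewrite /= hE /= gK.
Qed.

(** Lifting the finitely many [f (b j)] suffices: the coordinate forms [phi]
    then extend the choice linearly. *)
Lemma dual_basis_projective M (J : finType) (b : J -> M)
    (phi : J -> {linear M -> A^o}) :
    fin_dim M -> (forall m, m = \sum_j (phi j m : A) *: b j) ->
  projective_module M.
Proof.
move=> fdM dual; split=> // X Y g f fdX fdY surjg.
have [x xP] := choice (fun j => surjg (f (b j))).
pose h m := \sum_j (phi j m : A) *: x j.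
have h_lin : linear h.
  move=> a u v; rewrite /h scaler_sumr -big_split; apply: eq_bigr => j _ /=.
  by rewrite linearP scalerDl scalerA.
exists (HB.pack h (GRing.isLinear.Build A M X *:%R h h_lin) : {linear M -> X}).
move=> m; rewrite /= /h linear_sum [in RHS](dual m) linear_sum.
by apply: eq_bigr => j _; rewrite !linearZ /= xP.
Qed.

Lemma projective_embeds P :
    (forall k, fin_dim 'rV[A]_k) -> projective_module P ->
  exists k (h : {linear P -> 'rV[A]_k}), injective h.
Proof.
move=> fdA [[s spans] liftP]; pose k := size s.
pose g (u : 'rV[A]_k) : P := \sum_i u 0 i *: s`_i.
have g_lin : linear g.
  move=> a u v; rewrite /g scaler_sumr -big_split; apply: eq_bigr => j _ /=.
  by rewrite !mxE scalerDl scalerA.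
pose gL : {linear 'rV[A]_k -> P} :=
  HB.pack g (GRing.isLinear.Build A 'rV[A]_k P *:%R g g_lin).
have surjg : surjective_hom gL.
  move=> v; have [c ->] := spans v; exists (\row_i (c i)%:A).
  by apply: eq_bigr => i _; rewrite mxE.
have fdP : fin_dim P by exists s.
have [h hE] := liftP _ _ gL idfun (fdA k) fdP surjg.
by exists k, h; apply: can_inj hE.
Qed.

Lemma kernel_closed M N (f : {linear M -> N}) :
  submod_closed [pred x | f x == 0].
Proof.
split=> [|a u v]; first by rewrite inE linear0.
by rewrite !inE linearP => /eqP -> /eqP ->; rewrite scaler0 addr0.
Qed.

(** A map that is injective on the image of an essential map is injective,
    because its kernel would otherwise meet that image. *)
Lemma essential_injective M N P (i : {linear M -> N}) (f : {linear N -> P}) :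
  essential_image i -> (forall m, f (i m) = 0 -> i m = 0) -> injective f.
Proof.
move=> essi fi; apply: raddf_inj => x fx0; apply/eqP/negPn/negP => x0.
have [|m /andP[]] := essi _ (kernel_closed f).
  by exists x; rewrite ?inE ?fx0.
by rewrite inE => /eqP /fi ->; rewrite eqxx.
Qed.

(** Injectivity extends [i'] to a map [h], which is injective because it is so
    on an essential submodule; for the same reason the retraction of [h] is
    injective, hence inverse to [h]. *)
Lemma envelope_unique M I I' (i : {linear M -> I}) (i' : {linear M -> I'}) :
    fin_dim M -> injective_envelope i -> injective_envelope i' ->
  exists (h : {linear I -> I'}) (k : {linear I' -> I}),
    [/\ cancel h k, cancel k h & forall m, h (i m) = i' m].
Proof.
move=> fdM [[fdI injI] inji essi] [[fdI' injI'] inji' essi'].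
have [h hE] := injI' _ _ i i' fdM fdI inji.
have injh : injective h.
  apply: essential_injective essi _ => m; rewrite hE => /eqP.
  by rewrite (raddf_eq0 _ inji') => /eqP ->; rewrite linear0.
have [k kE] := injI _ _ h idfun fdI fdI' injh.
have hK : cancel h k by exact: kE.
have injk : injective k.
  apply: essential_injective essi' _ => m; rewrite -hE hK => ->.
  by rewrite linear0.
by exists h, k; split=> // x; apply: injk; rewrite hK.
Qed.

Lemma envelope_projective M I I' (i : {linear M -> I}) (i' : {linear M -> I'}) :
    fin_dim M -> injective_envelope i -> injective_envelope i' ->
  projective_module I -> projective_module I'.
Proof.
move=> fdM envi envi' projI.
have [h [k [_ kK _]]] := envelope_unique fdM envi envi'.
exact: (projective_retract kK).
Qed.

Lemma zero_module (x : 'rV[A]_0) : x = 0.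
Proof. exact: thinmx0. Qed.

Lemma zero_module_fin_dim : fin_dim 'rV[A]_0.
Proof.
exists [::] => v; exists (fun=> 0); rewrite big_ord0.
exact: zero_module.
Qed.

Lemma trivial_projective M :
  fin_dim M -> (forall x : M, x = 0) -> projective_module M.
Proof.
move=> fdM M0; split=> // X Y g f _ _ _.
by exists \0 => x; rewrite (M0 x) !linear0.
Qed.

Lemma zero_module_injective : injective_module 'rV[A]_0.
Proof.
split=> [|X Y g f _ _ _]; first exact: zero_module_fin_dim.
by exists \0 => x; rewrite [RHS]zero_module.
Qed.

(** Minimality of a resolution is thus automatic where it becomes exact. *)
Lemma surjective_essential M N (f : {linear M -> N}) :
  surjective_hom f -> essential_image f.
Proof.
by move=> surjf U _ [u uU u0]; have [m mE] := surjf u; exists m; rewrite mE uU.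
Qed.

Lemma surjective_factor M N P (p : {linear M -> N}) (f : {linear M -> P}) :
    surjective_hom p -> (forall x, p x = 0 -> f x = 0) ->
  exists g : {linear N -> P}, forall x, g (p x) = f x.
Proof.
move=> surjp fp; have [r rP] := choice surjp.
have fr x : f (r (p x)) = f x.
  by apply/subr0_eq; rewrite -linearB fp // linearB rP subrr.
have g_lin : linear (f \o r).
  by move=> a u v; rewrite -(rP u) -(rP v) -linearP /= !fr linearP.
by exists (HB.pack (f \o r) (GRing.isLinear.Build A N P *:%R (f \o r) g_lin)
           : {linear N -> P}).
Qed.

Section TwoTermResolution.
Variables (M I C : lmodType A) (i : {linear M -> I}) (p : {linear I -> C}).
Hypotheses (envi : injective_envelope i) (injC : injective_module C).
Hypotheses (surjp : surjective_hom p).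
Hypothesis kerp : forall x, p x = 0 <-> exists m, i m = x.

Definition two_term (j : nat) : lmodType A :=
  match j with 0 => I | 1 => C | _ => 'rV[A]_0 end.

Definition two_term_diff (j : nat) : {linear two_term j -> two_term j.+1} :=
  if j is 0 then p else \0.

Lemma two_term_resolution :
  exists R : min_inj_resolution M, mir_term R = two_term.
Proof.
have [injI inji essi] := envi.
unshelve eexists (@MinInjResolution K A M two_term i two_term_diff _ _ _ _ _ _).
- by case=> [|[|j]] //; apply: zero_module_injective.
- exact: inji.
- exact: kerp.
- case=> [|j] x; split=> // _.
  by exists 0; rewrite [RHS]zero_module.
- exact: essi.
- case=> [|j]; first exact: surjective_essential.
  by move=> U _ [u _]; rewrite (zero_module u) eqxx.
by [].
Qed.

(** The first term of any minimal resolution of [M] is isomorphic to [I], and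
    its second term is an injective envelope of the cokernel of [M] in the
    first.  As [C] is injective, it is its own envelope, hence isomorphic to
    that second term. *)
Lemma two_term_projective :
    fin_dim M -> dom_dim_ge M 2 -> projective_module C.
Proof.
move=> fdM [R projR]; have [_ inji essi] := envi.
have envR : injective_envelope (mir_aug R).
  split; [exact: mir_injective | exact: mir_aug_inj|].
  exact: mir_aug_essential.
have [h [k [hK kK hi]]] := envelope_unique fdM envi envR.
have [f fp] : exists f : {linear C -> mir_term R 1},
    forall x, f (p x) = (mir_diff R 0 \o h) x.
  apply: surjective_factor => // x /kerp [m <-] /=.
  by rewrite hi; apply/mir_exact0; exists m.
have injf : injective f.
  apply: raddf_inj => c; have [x <-] := surjp c.
  move=> fpx; have dx0 : mir_diff R 0 (h x) = 0 by rewrite -[LHS]fp.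

  have [m mE] := (mir_exact0 (h x)).1 dx0.
  by apply/kerp; exists m; apply: (can_inj hK); rewrite hi.
have essf : essential_image f.
  move=> U clU [u uU u0].
  have [y] := mir_diff_essential clU (ex_intro2 _ _ u uU u0).
  by exists (p (k y)); rewrite fp /= kK.
have [fdC _] := injC.
have envf : injective_envelope f by split=> //; exact: mir_injective.
have env1 : @injective_envelope K A C C idfun.
  by split=> //; apply: surjective_essential => y; exists y.
apply: envelope_projective fdC envf env1 _.
by have [] := projR 1 isT.
Qed.

(** If the cokernel of an essential map is projective, then the map is a split
    monomorphism; its complement avoids the image and is thus zero. *)
Lemma projective_cokernel : projective_module C -> forall x, exists m, i m = x.
Proof.
move=> projC x; have [_ _ essi] := envi; have [[fdI _] _ _] := envi.
have [fdC _] := injC.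
have [s sE] := projC.2 _ _ p idfun fdI fdC surjp.
have sK : cancel s p by exact: sE.
apply/kerp/eqP/negPn/negP => px0.
(* The image of [s], written as the fixed points of the projection onto it. *)
have clU : submod_closed [pred y | s (p y) == y].
  split=> [|a u v]; first by rewrite inE !linear0.
  by rewrite !inE !linearP => /eqP -> /eqP ->.
have [|m] := essi _ clU.
  exists (s (p x)); first by rewrite inE sK.
  by apply: contra px0 => /eqP sp0; rewrite -(sK (p x)) sp0 linear0.
rewrite inE (kerp (i m)).2; last by exists m.
by rewrite linear0 eq_sym => /andP[->].
Qed.

End TwoTermResolution.

Section DominantDimension.
Variable M : lmodType A.

Lemma dom_dim_geW m n : (m <= n)%N -> dom_dim_ge M n -> dom_dim_ge M m.
Proof.
by move=> mn [R RP]; exists R => j jm; apply: RP; apply: leq_trans mn.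
Qed.

Lemma dom_dim_eq0 : nonprojective_envelope M -> dom_dim M = Some 0%N.
Proof. by rewrite /dom_dim; case: pselect. Qed.

(** The bounds [dom_dim_ge M n] are decreasing in [n], so only one value of [n]
    can be the last for which they hold, whichever is chosen in [dom_dim]. *)
Lemma dom_dim_eqS n :
    ~ nonprojective_envelope M -> dom_dim_ge M n.+1 -> ~ dom_dim_ge M n.+2 ->
  dom_dim M = Some n.+1.
Proof.
move=> proj geM ngeM; rewrite /dom_dim.
case: pselect => //= _.
case: pselect => [ex|[]]; last by exists n.+1.
case: (cid ex) => m /= [_ gem ngem]; congr Some; apply/eqP; rewrite eqn_leq.
apply/andP; split; rewrite leqNgt; apply/negP => lt.
  by apply: ngeM; apply: dom_dim_geW gem.
by apply: ngem; apply: dom_dim_geW geM.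
Qed.

Lemma dom_dim_eqoo :
    ~ nonprojective_envelope M -> (forall n, dom_dim_ge M n) ->
  dom_dim M = None.
Proof.
move=> proj geM; rewrite /dom_dim.
case: pselect => //= _.
by case: pselect => // ex; case: ex => n [_ _ []].
Qed.

End DominantDimension.

End ModuleTheory.

(** * Modules over a path algebra *)

Section PathModules.
Variables (K : fieldType) (Q : quiver).
Local Notation A := (path_algebra K Q).
Implicit Types (x : vertex Q) (a : arrow Q) (p q r : qpath Q).

Lemma walk_arrow a : walk (src a) [:: a].
Proof. by rewrite /= eqxx. Qed.

Definition path_arrow a : qpath Q := path_of (walk_arrow a).

Definition idem x : A := path_basis K (path_triv x).

Definition arr a : A := path_basis K (path_arrow a).

Lemma path_basisM p q :
  path_basis K p * path_basis K q = oapp (@path_basis K Q) 0 (path_comp p q).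
Proof. exact: pa_mul_basis. Qed.

Lemma idemM x p :
  idem x * path_basis K p = if x == path_end p then path_basis K p else 0.
Proof. by rewrite path_basisM path_comp_trivl; case: ifP. Qed.

Lemma basis_idem x p :
  path_basis K p * idem x = if x == path_start p then path_basis K p else 0.
Proof. by rewrite path_basisM path_comp_trivr; case: ifP. Qed.

Lemma idem_arr x a : idem x * arr a = if x == tgt a then arr a else 0.
Proof. exact: idemM. Qed.

Lemma arr_idem x a : arr a * idem x = if x == src a then arr a else 0.
Proof. exact: basis_idem. Qed.

(** Paths are taken apart at their first arrow, which is the factor on the
    right of the product. *)
Variant path_first_spec p : Prop :=
| PathTriv x of p = path_triv x
| PathFirst q a of path_start q = tgt a & path_start p = src a
    & path_end p = path_end q & (val p).2 = a :: (val q).2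
    & path_comp q (path_arrow a) = Some p.

Lemma path_firstP p : path_first_spec p.
Proof.
case: p => [[x [|a s]] w]; first by apply: (PathTriv (x := x)); apply: path_eq.
have /andP[/eqP sa ws] : walk x (a :: s) := w.
apply: (@PathFirst _ (path_of ws) a) => //.
case: path_compP => [r _ sr _ ar|/eqP[]//].
by congr Some; apply: path_eq; rewrite ?sr ?ar //= -sa.
Qed.

Lemma path_basis_sum (s : seq (qpath Q)) (u : A) :
    uniq s -> (forall p, p \in s) ->
  u = \sum_(p <- s) pa_coef u p *: path_basis K p.
Proof.
move=> us ss; apply: pa_coefP => q; rewrite pa_coef_sum.
rewrite (bigD1_seq q) //= pa_coefZ pa_coef_basis eqxx mulr1 big1 ?addr0 //.
by move=> p /negPf pq; rewrite pa_coefZ pa_coef_basis pq mulr0.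
Qed.

Lemma scale_algl (M : lmodType A) (c : K) (u : A) (v : M) :
  (c *: u) *: v = c%:A *: (u *: v).
Proof. by rewrite scalerA mulr_algl. Qed.

Lemma path_linear (M N : lmodType A) (h : M -> N) :
    (forall c u v, h (c%:A *: u + v) = c%:A *: h u + h v) ->
    (forall r v, h (path_basis K r *: v) = path_basis K r *: h v) ->
  linear h.
Proof.
move=> hlin hr; have hD u v : h (u + v) = h u + h v.
  by have := hlin 1 u v; rewrite !scale1r.
have h0 : h 0 = 0 by apply: (addrI (h 0)); rewrite -hD !addr0.
have hZ c v : h (c%:A *: v) = c%:A *: h v.
  by have := hlin c v 0; rewrite h0 !addr0.
move=> u v w; rewrite hD; congr (_ + _); rewrite [u]path_basisE !scaler_suml.
rewrite (big_morph h hD h0); apply: eq_bigr => r _.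
by rewrite (scale_algl _ _ v) hZ hr [RHS]scale_algl.
Qed.

Hypothesis acQ : acyclic Q.

Lemma fin_dim_generated (M : lmodType A) (J : finType) (b : J -> M) :
    (forall v, exists c : J -> A, v = \sum_j c j *: b j) ->
  fin_dim M.
Proof.
move=> genb; pose L := all_paths Q.
pose bb (ij : 'I_(size L) * J) :=
  path_basis K (tnth (in_tuple L) ij.1) *: b ij.2.
apply: (@fin_dim_family K A M _ bb) => v; have [c ->] := genb v.
exists (fun ij => pa_coef (c ij.2) (tnth (in_tuple L) ij.1)).
rewrite -(pair_bigA _ (fun i j =>
  (pa_coef (c j) (tnth (in_tuple L) i))%:A *: bb (i, j))).
rewrite exchange_big; apply: eq_bigr => j _ /=.
rewrite {1}(path_basis_sum (c j) (all_paths_uniq Q) (mem_all_paths acQ)).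
rewrite scaler_suml [LHS]big_tnth; apply: eq_bigr => i _.
by rewrite /bb scalerA mulr_algl.
Qed.

Lemma regular_fin_dim : fin_dim (A^o : lmodType A).
Proof.
apply: (@fin_dim_generated _ unit (fun=> 1)) => v; exists (fun=> v).
by rewrite (big_pred1 tt) ?[_ *: _]mulr1 // => -[].
Qed.

Lemma row_fin_dim k : fin_dim 'rV[A]_k.
Proof.
apply: (@fin_dim_generated _ 'I_k (fun i => delta_mx 0 i)) => v.
exists (fun i => v 0 i); exact: row_sum_delta.
Qed.

Section Injectivity.
Variable M : lmodType A.

(** The vanishing of [Ext^1(S_x, M)] for every simple module [S_x], computed
    with the resolution of [S_x] by [A e_x] and the sum of the [A e_(tgt a)],
    for [a] leaving [x]. *)
Definition out_surjective := forall x (m : arrow Q -> M),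
  (forall a, src a = x -> idem (tgt a) *: m a = m a) ->
  exists2 n : M, idem x *: n = n & forall a, src a = x -> arr a *: n = m a.

Section Extension.
Variable Y : lmodType A.

(** A homomorphism from a submodule of [Y] to [M] is encoded by its graph, so
    that its domain can be enlarged step by step. *)
Definition hom_graph (G : Y -> M -> Prop) :=
  [/\ G 0 0,
      forall u y y' m m', G y m -> G y' m' -> G (u *: y + y') (u *: m + m')
    & forall m, G 0 m -> m = 0].

Lemma hom_graphD G y y' m m' :
  hom_graph G -> G y m -> G y' m' -> G (y + y') (m + m').
Proof.
case=> _ /(_ 1) lin _; rewrite -{2}[y]scale1r -{2}[m]scale1r.
exact: lin.
Qed.

Lemma hom_graphZ G u y m : hom_graph G -> G y m -> G (u *: y) (u *: m).
Proof.
by case=> G0 lin _ Gym; rewrite -[u *: y]addr0 -[u *: m]addr0; exact: lin.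
Qed.

Definition adjoin (G : Y -> M -> Prop) y m : Y -> M -> Prop :=
  fun v w => exists c : K, G (v - c%:A *: y) (w - c%:A *: m).

(** Arrows send [y] into the domain of [G] and idempotents fix or kill it, so
    that [A] maps the line through [(y, m)] into that line plus [G]. *)
Lemma adjoin_graph G x y m :
    hom_graph G -> idem x *: y = y -> idem x *: m = m ->
    (forall a, src a = x -> G (arr a *: y) (arr a *: m)) ->
    ~ (exists n, G y n) ->
  hom_graph (adjoin G y m).
Proof.
move=> graphG ey em Ga noty; have [G0 lin func] := graphG.
pose R (u : A) := exists d : K, G (u *: y - d%:A *: y) (u *: m - d%:A *: m).
have adjy u : R u.
  rewrite [u]path_basisE; apply: (big_ind R) => [|u1 u2 [d1 G1] [d2 G2]|p _].
  - by exists 0; rewrite !scale0r !subr0.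
  - exists (d1 + d2); rewrite !scalerDl !opprD.
    rewrite (addrACA (u1 *: y)) (addrACA (u1 *: m)).
    exact: hom_graphD.
  set c := pa_coef u p.
  case: (path_firstP p) => [z ->|q a _ _ _ _ pE].
    have [->|zx] := eqVneq z x.
      by exists c; rewrite -/(idem x) !(scale_algl c (idem x)) ey em !subrr.
    exists 0; rewrite !(scale_algl c (idem z)) -ey -em.
    rewrite !(scalerA (idem z)) basis_idem eq_sym (negPf zx).
    by rewrite !scale0r !scaler0 !subrr.
  exists 0; rewrite !scale0r !subr0.
  have -> : path_basis K p = path_basis K q * arr a by rewrite path_basisM pE.
  rewrite (scale_algl c _ y) (scale_algl c _ m) -!(scalerA (path_basis K q)).
  do 2 apply: hom_graphZ => //.
  have [ax|ax] := eqVneq (src a) x; first exact: Ga.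
  by rewrite -ey -em !(scalerA (arr a)) arr_idem eq_sym (negPf ax) !scale0r.
split.
- by exists 0; rewrite !scale0r !subr0.
- move=> u v v' w w' [c Gc] [c' Gc']; have [d Gd] := adjy u.
  exists (c * d + c').
  suff E (N : lmodType A) (n z z' : N) :
      u *: z + z' - (c * d + c')%:A *: n =
      u *: (z - c%:A *: n) + (c%:A *: (u *: n - d%:A *: n) + (z' - c'%:A *: n)).
    by rewrite !E; apply: (lin _ _ _ _ _ Gc); exact: (lin _ _ _ _ _ Gd Gc').
  have cu : c%:A * u = u * c%:A by rewrite mulr_algl mulr_algr.
  rewrite !scalerBr !scalerA cu mulr_algl scalerA.
  by rewrite addrA (addrA (_ - _) (_ *: n)) subrK !scalerDl opprD addrACA.
- move=> w [c Gc]; have [c0|c0] := eqVneq c 0.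
    by apply: func; move: Gc; rewrite c0 !scale0r !subr0.
  case: noty; exists ((- c^-1)%:A *: (w - c%:A *: m)).
  have := hom_graphZ (- c^-1)%:A graphG Gc.
  rewrite sub0r scalerN scalerA mulr_algl scalerA mulNr mulVf //.
  by rewrite scaleN1r scaleNr opprK scale1r.
Qed.

(** The value at [y] has to be mapped by each arrow [a] to the known value at
    [a y]; surjectivity at [x] provides it. *)
Lemma extend_graph G x y :
    out_surjective -> hom_graph G -> idem x *: y = y ->
    (forall a, src a = x -> exists n, G (arr a *: y) n) ->
  exists2 G', hom_graph G'
    & (forall v w, G v w -> G' v w) /\ exists n, G' y n.
Proof.
move=> outM graphG ey Ga; have [domy|domy] := pselect (exists n, G y n).
  by exists G.
have /choice [m mP] a : exists n, src a = x ->
    G (arr a *: y) n /\ idem (tgt a) *: n = n.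
  have [sa|sa] := pselect (src a = x); last by exists 0.
  have [n Gn] := Ga a sa; exists (idem (tgt a) *: n) => _.
  rewrite scalerA idemM eqxx; split=> //.
  by have := hom_graphZ (idem (tgt a)) graphG Gn; rewrite scalerA idem_arr eqxx.
have [a /mP []//|n en nP] := outM x m.
exists (adjoin G y n).
  by apply: (adjoin_graph (x := x)) => // a sa; rewrite nP //; case: (mP a sa).
split=> [v w Gvw|].
  by exists 0; rewrite !scale0r !subr0.
by exists n, 1; rewrite !scale1r !subrr; case: graphG.
Qed.

Lemma extend_graph_seq G (L : seq Y) :
    out_surjective -> hom_graph G ->
    (forall y, y \in L -> exists2 x, idem x *: y = y
       & forall a, src a = x -> exists n, G (arr a *: y) n) ->
  exists2 G', hom_graph G' & (forall v w, G v w -> G' v w) /\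
    forall y, y \in L -> exists n, G' y n.
Proof.
move=> outM; elim: L G => [|y L IHL] G graphG GL; first by exists G.
have [x ey Gy] := GL y (mem_head _ _).
have [G1 graph1 [sub1 dom1]] := extend_graph outM graphG ey Gy.
have [z zL|G2 graph2 [sub2 dom2]] := IHL G1 graph1.
  have [x' ez Gz] := GL z (mem_behead (s := y :: L) zL); exists x' => // a sa.
  by have [n Gn] := Gz a sa; exists n; apply: sub1.
exists G2 => //; split=> [v w /sub1|z]; first exact: sub2.
rewrite inE => /orP[/eqP ->|/dom2 //].
by have [n Gn] := dom1; exists n; apply: sub2.
Qed.

(** Long paths come first: an arrow turns [p y] into [p' y] for a longer path
    [p'], or into zero. *)
Lemma extend_graph_paths G (s : seq Y) k :
    out_surjective -> hom_graph G ->
    (forall p y, y \in s -> (k <= size (val p).2)%N ->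
       exists n, G (path_basis K p *: y) n) ->
  exists2 G', hom_graph G' & (forall v w, G v w -> G' v w) /\
    forall p y, y \in s -> exists n, G' (path_basis K p *: y) n.
Proof.
move=> outM; elim: k G => [|k IHk] G graphG Gs.
  by exists G => //; split=> // p y ys; apply: Gs.
pose L := [seq path_basis K p *: y |
  p <- [seq p <- all_paths Q | size (val p).2 == k], y <- s].
have [z /allpairsP[[p y] [/=]]|G1 graph1 [sub1 dom1]] :=
    extend_graph_seq (L := L) outM graphG.
  rewrite mem_filter => /andP[/eqP sp _] ys ->; exists (path_end p).
    by rewrite scalerA idemM eqxx.
  move=> a sa; rewrite scalerA path_basisM.
  case: path_compP => [r _ _ _ rE|/eqP[]//]; apply: Gs => //.
  by rewrite rE size_cat sp addn1.
have [p y ys kp|G2 graph2 [sub2 dom2]] := IHk G1 graph1.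
  move: kp; rewrite leq_eqVlt => /orP[/eqP kp|kp].
    apply: dom1; apply: allpairs_f => //.
    by rewrite mem_filter -kp eqxx mem_all_paths.
  by have [n Gn] := Gs p y ys kp; exists n; apply: sub1.
by exists G2 => //; split=> // v w /sub1; exact: sub2.
Qed.

End Extension.

(** No path has [#|vertex Q|] arrows, so that the extension can start from the
    graph of [f] itself. *)
Lemma out_surjective_injective :
  fin_dim M -> out_surjective -> injective_module M.
Proof.
move=> fdM outM; split=> // X Y g f _ [s spans] injg.
pose G0 (y : Y) (m : M) := exists2 x, g x = y & f x = m.
have graph0 : hom_graph G0.
  split.
  - by exists 0; rewrite linear0.
  - move=> u _ _ _ _ [z <- <-] [z' <- <-].
    by exists (u *: z + z'); rewrite linearP.
  - move=> m [z /eqP]; rewrite (raddf_eq0 _ injg) => /eqP -> <-.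
    by rewrite linear0.
have [p y _|G graphG [subG domG]] :=
    extend_graph_paths (k := #|vertex Q|) (s := s) outM graph0.
  by rewrite leqNgt (walk_size acQ (valP p)).
have domZ u y : (exists n, G y n) -> exists n, G (u *: y) n.
  by case=> n Gn; exists (u *: n); apply: hom_graphZ.
have domS (J : finType) (F : J -> Y) :
    (forall j, exists n, G (F j) n) -> exists n, G (\sum_j F j) n.
  move=> domF; apply: (big_ind (fun y => exists n, G y n)) => //.
  - by exists 0; case: graphG.
  - by move=> y y' [n Gn] [n' Gn']; exists (n + n'); apply: hom_graphD.
have /choice [h hP] y : exists n, G y n.
  have [c ->] := spans y; apply: (domS) => i; apply: domZ.
  rewrite -[s`_i]scale1r -[1]/(pa_one K Q) pa_one.unlock scaler_suml.
  by apply: domS => x; apply: domG; apply: mem_nth.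
have [_ lin func] := graphG.
have uniqG y n n' : G y n -> G y n' -> n = n'.
  move=> Gn Gn'; apply/subr0_eq/func.
  by have := lin (-1) _ _ _ _ Gn' Gn; rewrite !scaleN1r addNr addrC.
have h_lin : linear h.
  by move=> u v w; apply: uniqG (hP _) _; apply: (lin).
exists (HB.pack h (GRing.isLinear.Build A Y M *:%R h h_lin) : {linear Y -> M}).
by move=> z; apply: uniqG (hP _) _; apply: subG; exists z.
Qed.

End Injectivity.

(** At each vertex the arrows that enter it are jointly injective, which is the
    vanishing of [Tor_1] of the simple right modules with [M].  The sum may run
    over all arrows, because the idempotents separate their targets. *)
Definition in_independent (M : lmodType A) := forall m : arrow Q -> M,
  (forall a, idem (src a) *: m a = m a) -> \sum_a arr a *: m a = 0 ->
  forall a, m a = 0.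

Lemma pa_coef_arr_basis a c p q r :
    path_comp (path_arrow a) p = Some q ->
  pa_coef (arr c * path_basis K r) q = ((c == a) && (r == p))%:R.
Proof.
rewrite path_basisM; case: path_compP => // q' pa sq eq qs [<-].
case: path_compP => [t rc st et ts|rc] /=.
  rewrite pa_coef_basis; congr (nat_of_bool _)%:R; apply/eqP/andP => [tq|].
    move: st ts; rewrite tq sq qs /= !cats1 => st /rcons_inj[pr ->].
    by split=> //; apply/eqP/path_eq.
  by case=> /eqP cE /eqP rE; apply: path_eq; rewrite ?st ?sq ?ts ?qs ?cE rE.
rewrite pa_coef0; case: eqVneq => //= ca; case: eqVneq => //= rp.
by move: rc; rewrite rp -pa ca eqxx.
Qed.

Lemma pa_coef_arrM a c (u : A) p q :
    path_comp (path_arrow a) p = Some q ->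
  pa_coef (arr c * u) q = (c == a)%:R * pa_coef u p.
Proof.
move=> qE; have uE := path_basis_sum u (all_paths_uniq Q) (mem_all_paths acQ).
rewrite {1}uE mulr_sumr pa_coef_sum {2}uE pa_coef_sum mulr_sumr.
apply: eq_bigr => r _; rewrite -scalerAr !pa_coefZ pa_coef_basis mulrCA.
by rewrite (pa_coef_arr_basis _ _ qE) -natrM mulnb.
Qed.

Lemma pa_coef_idemM x (u : A) p :
  pa_coef (idem x * u) p = (x == path_end p)%:R * pa_coef u p.
Proof.
have uE := path_basis_sum u (all_paths_uniq Q) (mem_all_paths acQ).
rewrite {1}uE mulr_sumr pa_coef_sum {2}uE pa_coef_sum mulr_sumr.
apply: eq_bigr => r _; rewrite -scalerAr !pa_coefZ mulrCA; congr (_ * _).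
rewrite idemM pa_coef_basis -natrM mulnb andbC.
case: (eqVneq r p) => [->|rp]; case: eqVneq => //= _; rewrite ?pa_coef0 //.
  by rewrite pa_coef_basis eqxx.
by rewrite pa_coef_basis (negPf rp).
Qed.

(** The paths [a p], for distinct arrows [a], are distinct. *)
Lemma regular_in_independent : in_independent A^o.
Proof.
move=> m em sum0 a; apply: pa_coefP => p; rewrite pa_coef0 -em.
have [pa|pa] := eqVneq (src a) (path_end p); last first.
  by rewrite [LHS]pa_coef_idemM (negPf pa) mul0r.
case qE: (path_comp (path_arrow a) p) => [q|]; last first.
  by move: qE; case: path_compP => // /eqP[].
have := congr1 (fun u => pa_coef u q) sum0; rewrite pa_coef0 pa_coef_sum.
rewrite (bigD1 a) //= big1 => [|b ba]; rewrite (pa_coef_arrM _ _ qE).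
  by rewrite eqxx mul1r addr0 em.
by rewrite (negPf ba) mul0r.
Qed.

(** The condition passes from free modules to their submodules. *)
Lemma projective_in_independent (M : lmodType A) :
  projective_module M -> in_independent M.
Proof.
move=> projM; have [k [h injh]] := projective_embeds row_fin_dim projM.
move=> m em sum0 a; apply: injh; rewrite linear0; apply/rowP => j.
rewrite mxE; apply: (regular_in_independent (m := fun a => h (m a) 0 j)).
  by move=> b; rewrite -[in RHS]em linearZ mxE.
have /rowP /(_ j) := congr1 h sum0.
rewrite linear0 linear_sum summxE mxE => sumj.
by apply: etrans sumj; apply: eq_bigr => b _; rewrite linearZ mxE.
Qed.

Section Simple.
Variables (M : lmodType A) (i : {linear A^o -> M}).
Hypotheses (injM : injective i).
Hypotheses (outM : out_surjective M) (inM : in_independent M).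

Lemma vertex_neq0 x : exists2 w : M, idem x *: w = w & w != 0.
Proof.
exists (i (idem x)); first by rewrite -linearZ /= [_ *: _]idemM eqxx.
rewrite raddf_eq0 //; apply/eqP => /(congr1 (fun u => pa_coef u (path_triv x))).
by rewrite pa_coef_basis eqxx pa_coef0 => /eqP; rewrite oner_eq0.
Qed.

(** If [a] and [b] are distinct and leave the same vertex, some [n] there
    satisfies [a n = 0] and [b n = w] with [w] nonzero; but [a] is injective. *)
Lemma module_out_simple : out_simple Q.
Proof.
move=> a b ab; apply/eqP/negPn/negP => ne.
have [w ew w0] := vertex_neq0 (tgt b).
have [c _|n en nP] := @outM (src b) (fun c => if c == b then w else 0).
  by case: eqVneq => [->|_]; rewrite ?ew ?scaler0.
have n0 : n = 0.
  have := @inM (fun c => if c == a then n else 0) _ _ a.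
  rewrite eqxx; apply=> [c|].
    by case: eqVneq => [->|_]; rewrite ?ab ?en ?scaler0.
  rewrite big1 // => c _; case: eqVneq => [->|_]; last by rewrite scaler0.
  by rewrite nP ?(negPf ne).
by have := nP b erefl; rewrite eqxx n0 scaler0 => /esym/eqP; apply/negP.
Qed.

(** If [a] and [b] are distinct and enter the same vertex, then [b w = a n] for
    some [n], since [a] is surjective; independence of [a] and [b] yields
    [w = 0]. *)
Lemma module_in_simple : in_simple Q.
Proof.
move=> a b ab; apply/eqP/negPn/negP => ne.
have [w ew w0] := vertex_neq0 (src b).
have [c _|n en nP] :=
    @outM (src a) (fun c => if c == a then arr b *: w else 0).
  case: eqVneq => [->|_]; last by rewrite scaler0.
  by rewrite scalerA idem_arr ab eqxx.
have := @inM (fun c => if c == a then n else if c == b then - w else 0) _ _ b.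
rewrite eq_sym (negPf ne) eqxx => wE.
suff /eqP : - w = 0 by rewrite oppr_eq0; apply/negP.
apply: wE => [c|].
  case: eqVneq => [->//|_]; case: eqVneq => [->|_]; last by rewrite scaler0.
  by rewrite scalerN ew.
rewrite (bigD1 a) //= (bigD1 b) 1?eq_sym //= eqxx eq_sym (negPf ne) eqxx.
rewrite nP // eqxx scalerN big1 ?addr0 ?subrr // => c /andP[ca cb].
by rewrite (negPf ca) (negPf cb) scaler0.
Qed.

End Simple.
End PathModules.

(** * The injective envelope of a path algebra *)

Section PathCoefficients.
Variables (K : fieldType) (Q : quiver).
Local Notation A := (path_algebra K Q).
Hypothesis acQ : acyclic Q.

Lemma pa_coef_paths (F : qpath Q -> K) r :
  pa_coef (\sum_(p <- all_paths Q) F p *: path_basis K p) r = F r.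
Proof.
rewrite pa_coef_sum (bigD1_seq r) ?all_paths_uniq ?mem_all_paths //=.
rewrite pa_coefZ pa_coef_basis eqxx mulr1 big1 ?addr0 // => t /negPf tr.
by rewrite pa_coefZ pa_coef_basis tr mulr0.
Qed.

Lemma pa_coef_basisM_short (u : A) p r :
  (size (val r).2 < size (val p).2)%N -> pa_coef (path_basis K p * u) r = 0.
Proof.
move=> rp; rewrite [u]path_basisE mulr_sumr pa_coef_sum big1 // => q _.
rewrite -scalerAr pa_coefZ path_basisM.
case: path_compP => [t _ _ _ tE|_] /=; last by rewrite pa_coef0 mulr0.
rewrite pa_coef_basis; case: eqVneq => [tr|_]; last by rewrite mulr0.
by move: rp; rewrite -tr tE size_cat ltnNge leq_addl.
Qed.

Lemma pa_coef_basisM (u : A) p r t :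
  path_comp p r = Some t -> pa_coef (path_basis K p * u) t = pa_coef u r.
Proof.
move=> tE; have uE := path_basis_sum u (all_paths_uniq Q) (mem_all_paths acQ).
rewrite {1}uE mulr_sumr pa_coef_sum {2}uE pa_coef_sum.
apply: eq_bigr => r' _; rewrite -scalerAr !pa_coefZ pa_coef_basis path_basisM.
congr (_ * _); case: path_compP tE => // t' pr st et ts [<-].
case: path_compP => [v pr' sv ev vs|pr'] /=; last first.
  rewrite pa_coef0; case: (eqVneq r' r) => // r'r.
  by move: pr'; rewrite r'r pr eqxx.
rewrite pa_coef_basis; congr (nat_of_bool _)%:R; apply/eqP/eqP => [vt|r'r].
  apply: path_eq; first by rewrite -sv -st vt.
  move: vs; rewrite vt ts => rr.
  have /addIn sz : (size (val r).2 + size (val p).2 =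
    size (val r').2 + size (val p).2)%N by rewrite -!size_cat rr.
  by move/eqP: rr; rewrite eqseq_cat // => /andP[/eqP].
by apply: path_eq; rewrite ?sv ?st ?vs ?ts r'r.
Qed.

(** The linear extension of [F] from the basis of paths to [A]. *)
Definition path_eval (u : A) (F : qpath Q -> K) : K :=
  \sum_(r <- all_paths Q) pa_coef u r * F r.

Lemma path_eval_linear c u v F :
  path_eval (c *: u + v) F = c * path_eval u F + path_eval v F.
Proof.
rewrite /path_eval mulr_sumr -big_split; apply: eq_bigr => r _ /=.
by rewrite pa_coefD pa_coefZ mulrDl mulrA.
Qed.

Lemma path_eval0 F : path_eval 0 F = 0.
Proof. by rewrite /path_eval big1 // => r _; rewrite pa_coef0 mul0r. Qed.

Lemma path_evalD u v F : path_eval (u + v) F = path_eval u F + path_eval v F.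
Proof. by have := path_eval_linear 1 u v F; rewrite scale1r mul1r. Qed.

Lemma path_eval_sum I (s : seq I) (G : I -> A) F :
  path_eval (\sum_(i <- s) G i) F = \sum_(i <- s) path_eval (G i) F.
Proof.
exact: (big_morph (fun u => path_eval u F) (fun u v => path_evalD u v F)
          (path_eval0 F)).
Qed.

Lemma path_evalZ c u F : path_eval (c *: u) F = c * path_eval u F.
Proof. by have := path_eval_linear c u 0 F; rewrite path_eval0 !addr0. Qed.

Lemma path_eval_basis p F : path_eval (path_basis K p) F = F p.
Proof.
rewrite /path_eval (bigD1_seq p) ?all_paths_uniq ?mem_all_paths //=.
rewrite pa_coef_basis eqxx mul1r big1 ?addr0 // => r /negPf rp.
by rewrite pa_coef_basis eq_sym rp mul0r.
Qed.

End PathCoefficients.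

Section Envelope.
Variables (K : fieldType) (Q : quiver).
Local Notation A := (path_algebra K Q).
Implicit Types (p q r : qpath Q).

Definition sink (x : vertex Q) := [forall a : arrow Q, src a != x].

Definition sink_pair p q := sink (path_end p) && (path_end q == path_end p).

Definition sink_pairs : seq (qpath Q * qpath Q) :=
  [seq pq <- [seq (p, q) | p <- all_paths Q, q <- all_paths Q]
     | sink_pair pq.1 pq.2].

(** For [q] fixed, the functions of [p] form the dual of [e_y A], where [y] is
    the end of [q]; this is the injective envelope of the simple module [S_y].
    The paths [q] that end at sinks form a basis of the socle of [A].  The
    proof [acQ] is a parameter of the type because the action of [A] is
    associative only if [all_paths] is complete. *)
Definition socle_dual (acQ : acyclic Q) : Type :=
  {ffun seq_sub sink_pairs -> K}.

Variable acQ : acyclic Q.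
Local Notation E := (socle_dual acQ).

HB.instance Definition _ := GRing.Zmodule.on E.

Lemma mem_sink_pairs p q : ((p, q) \in sink_pairs) = sink_pair p q.
Proof.
rewrite mem_filter /=; apply: andb_idr => _.
by apply: allpairs_f; apply: mem_all_paths.
Qed.

Definition sd_coef (f : E) p q : K :=
  if insub (p, q) is Some t then (f : {ffun _ -> K}) t else 0.

Definition sd_make (F : qpath Q -> qpath Q -> K) : E :=
  [ffun t : seq_sub sink_pairs => F (val t).1 (val t).2].

Lemma sd_coefP (f g : E) :
  (forall p q, sink_pair p q -> sd_coef f p q = sd_coef g p q) -> f = g.
Proof.
move=> fg; apply/ffunP => t; have := valP t; have := fg (val t).1 (val t).2.
rewrite -mem_sink_pairs /sd_coef -surjective_pairing valK => fgt tin.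
exact: fgt.
Qed.

Lemma sd_coef_make F p q :
  sd_coef (sd_make F) p q = if sink_pair p q then F p q else 0.
Proof.
rewrite /sd_coef; case: insubP => [t|]; rewrite mem_sink_pairs.
  by move=> -> tE; rewrite ffunE tE.
by move/negPf->.
Qed.

Lemma sd_coef_notin f p q : ~~ sink_pair p q -> sd_coef f p q = 0.
Proof. by rewrite -mem_sink_pairs /sd_coef; case: insubP => // t ->. Qed.

Lemma sd_coefD f g p q : sd_coef (f + g) p q = sd_coef f p q + sd_coef g p q.
Proof. by rewrite /sd_coef; case: insub => [t|]; rewrite ?addr0 ?ffunE. Qed.

Lemma sd_coef0 p q : sd_coef 0 p q = 0.
Proof. by rewrite /sd_coef; case: insub => [t|]; rewrite ?ffunE. Qed.

Definition sd_act (u : A) (f : E) : E :=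
  sd_make (fun p q => path_eval (path_basis K p * u) (sd_coef f ^~ q)).

Lemma sd_coef_act u f p q : sink_pair p q ->
  sd_coef (sd_act u f) p q = path_eval (path_basis K p * u) (sd_coef f ^~ q).
Proof. by move=> spq; rewrite sd_coef_make spq. Qed.

(** Every path that occurs in [p u] ends where [p] does, so the values of
    [sd_act v f] that are needed on the left are all defined by its formula. *)
Lemma sd_actA u v f : sd_act u (sd_act v f) = sd_act (u * v) f.
Proof.
apply: sd_coefP => p q spq; rewrite !sd_coef_act // mulrA.
rewrite [in RHS](path_basis_sum (path_basis K p * u)
  (all_paths_uniq Q) (mem_all_paths acQ)).
rewrite mulr_suml path_eval_sum.
apply: eq_bigr => r _; rewrite -scalerAl path_evalZ sd_coef_make.
case: ifP => // /negbT nrq; rewrite mulr0.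
have -> : path_basis K p = idem K (path_end p) * path_basis K p.
  by rewrite idemM eqxx.
rewrite -mulrA (pa_coef_idemM acQ).
case: eqVneq => [pr|_]; last by rewrite !mul0r.
by move: nrq spq; rewrite /sink_pair pr => /negPf ->.
Qed.

Lemma sd_act1 : left_id 1 sd_act.
Proof.
move=> f; apply: sd_coefP => p q spq.
by rewrite sd_coef_act // mulr1 path_eval_basis.
Qed.

Lemma sd_actDr : right_distributive sd_act +%R.
Proof.
move=> u f g; apply: sd_coefP => p q spq.
rewrite sd_coefD !sd_coef_act // /path_eval -big_split.
apply: eq_bigr => r _ /=.
by rewrite sd_coefD mulrDr.
Qed.

Lemma sd_actDl f : {morph sd_act^~ f : u v / u + v}.
Proof.
move=> u v; apply: sd_coefP => p q spq.
by rewrite sd_coefD !sd_coef_act // mulrDr path_evalD.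
Qed.

HB.instance Definition _ := GRing.Zmodule_isLmodule.Build A E
  sd_actA sd_act1 sd_actDr sd_actDl.

Lemma sd_coefZ u (f : E) p q : sink_pair p q ->
  sd_coef (u *: f) p q = path_eval (path_basis K p * u) (sd_coef f ^~ q).
Proof. exact: sd_coef_act. Qed.

Lemma sd_coefZ_basis r (f : E) p q :
  sd_coef (path_basis K r *: f) p q =
  oapp (fun t => sd_coef f t q) 0 (path_comp p r).
Proof.
have [spq|spq] := boolP (sink_pair p q).
  rewrite sd_coefZ // path_basisM.
  by case: path_comp => [t|]; rewrite /= ?path_eval0 ?path_eval_basis.
rewrite sd_coef_notin //; case: path_compP => //= t _ _ et _.
by rewrite sd_coef_notin // /sink_pair et.
Qed.

Lemma sd_coef_sum I (s : seq I) (P : pred I) (F : I -> E) p q :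
  sd_coef (\sum_(i <- s | P i) F i) p q = \sum_(i <- s | P i) sd_coef (F i) p q.
Proof.
exact: (big_morph (fun f => sd_coef f p q) (fun f g => sd_coefD f g p q)
          (sd_coef0 p q)).
Qed.

Lemma sd_coefZ_alg c (f : E) p q : sd_coef (c%:A *: f) p q = c * sd_coef f p q.
Proof.
have [spq|spq] := boolP (sink_pair p q); last by rewrite !sd_coef_notin ?mulr0.
by rewrite sd_coefZ // mulr_algr path_evalZ path_eval_basis.
Qed.

Lemma socle_dual_fin_dim : fin_dim (E : lmodType A).
Proof.
apply: (@fin_dim_family K A E (seq_sub sink_pairs)
  (fun t => sd_make (fun p q => (val t == (p, q))%:R))) => f.
exists (fun t => (f : {ffun _ -> K}) t); apply: sd_coefP => p q spq.
have pqin : (p, q) \in sink_pairs by rewrite mem_sink_pairs.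
pose t := SeqSub pqin.
have -> : sd_coef f p q = (f : {ffun _ -> K}) t.
  by rewrite /sd_coef -[(p, q)]/(val t) valK.
rewrite sd_coef_sum (bigD1 t) //= big1 => [|t' t't];
  rewrite sd_coefZ_alg sd_coef_make spq.
  by rewrite eqxx mulr1 addr0.
by rewrite -[(p, q)]/(val t) (inj_eq val_inj) (negPf t't) mulr0.
Qed.

(** The image of [1]; at [(p, q)] the image of [u] takes as its value the
    coefficient of [q] in [p u], see [sd_coef_embed]. *)
Definition sd_unit : E := sd_make (fun p q => (p == q)%:R).

Definition sd_embed (u : A^o) : E := (u : A) *: sd_unit.

Lemma sd_embed_linear : linear sd_embed.
Proof. by move=> a u v; rewrite /sd_embed scalerDl scalerA. Qed.

HB.instance Definition _ := GRing.isLinear.Build A A^o E *:%R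
  sd_embed sd_embed_linear.

Lemma sd_coef_embed (u : A) p q : sink_pair p q ->
  sd_coef (sd_embed u) p q = pa_coef (path_basis K p * u) q.
Proof.
move=> spq; rewrite sd_coefZ // /path_eval.
rewrite (bigD1_seq q) ?all_paths_uniq ?mem_all_paths //=.
rewrite big1 ?addr0 => [|r /negPf rq];
  rewrite sd_coef_make ?rq ?if_same ?mulr0 //.
rewrite eqxx; move: spq; rewrite /sink_pair => /andP[spq /eqP ->].
by rewrite spq eqxx mulr1.
Qed.

Lemma path_to_sink x :
  exists p : qpath Q, path_start p = x /\ sink (path_end p).
Proof.
have [s ws es] := walk_to_sink acQ x.
by exists (path_of ws); split=> //; apply/forallP => a; exact: es.
Qed.

(** A path [r] that occurs in [u] extends to a path [p r] that ends at a sink,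
    and the coefficient of [p r] in [p u] is that of [r] in [u]. *)
Lemma sd_embed_inj : injective (@sd_embed : A^o -> E).
Proof.
apply: raddf_inj => u /= u0; apply: pa_coefP => r; rewrite pa_coef0.
have [p [sp ep]] := path_to_sink (path_end r).
case tE: (path_comp p r) => [t|]; last first.
  by move: tE; case: path_compP => // /eqP[].
have spt : sink_pair p t.
  rewrite /sink_pair ep; move: tE.
  by case: path_compP => // t' _ _ et _ [<-]; rewrite et eqxx.
rewrite -(pa_coef_basisM acQ u tE) -sd_coef_embed //.
by rewrite [sd_embed u]u0 sd_coef0.
Qed.

Lemma sink_path p : sink (path_start p) -> p = path_triv (path_start p).
Proof.
by case: (path_firstP p) => [x ->|q a _ -> _ _ _ /forallP/(_ a)]; rewrite ?eqxx.
Qed.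

(** If [f] does not vanish at [(p, q)], then [p f] is concentrated on the pairs
    whose first component is the trivial path at the end of [p], and is thus
    the image of a combination of paths, with coefficients [f (p, _)]. *)
Lemma sd_embed_essential : essential_image (@sd_embed : {linear A^o -> E}).
Proof.
move=> U clU [f fU f0].
have [p [q fpq]] : exists p q, sd_coef f p q != 0.
  apply: contrapT => nf; case/eqP: f0; apply: sd_coefP => p q _.
  by rewrite sd_coef0; apply: contrapT => /eqP fpq; apply: nf; exists p, q.
have spq : sink_pair p q by apply: contraNT fpq => /sd_coef_notin ->.
have /andP[sp _] := spq.
pose u : A := \sum_(r <- all_paths Q) sd_coef f p r *: path_basis K r.
have uE r : pa_coef u r = sd_coef f p r by exact: pa_coef_paths.
have iuE : sd_embed u = path_basis K p *: f.
  apply: sd_coefP => p' q' spq'; rewrite sd_coef_embed // sd_coefZ_basis.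
  have [p'p|p'p] := eqVneq (path_start p') (path_end p).
    have p'E : p' = path_triv (path_end p).
      by rewrite -p'p; apply: sink_path; rewrite p'p.
    rewrite p'E path_comp_trivl eqxx [LHS](pa_coef_idemM acQ) uE /=.
    by move: spq' => /andP[_ /eqP ->]; rewrite p'E eqxx mul1r.
  case: path_compP => [t /eqP|_ /=]; first by rewrite (negPf p'p).
  rewrite mulr_sumr pa_coef_sum big1 // => r _; rewrite -scalerAr pa_coefZ.
  have [->|fr] := eqVneq (sd_coef f p r) 0; first by rewrite mul0r.
  have /andP[_ /eqP rp] : sink_pair p r.
    by apply: contraNT fr => /sd_coef_notin ->.
  rewrite path_basisM.
  case: path_compP => [t|_]; last by rewrite pa_coef0 mulr0.
  by rewrite rp => /eqP; rewrite (negPf p'p).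
exists u; rewrite /= iuE; apply/andP; split.
  by have := clU.2 (path_basis K p) f 0 fU clU.1; rewrite addr0.
apply: contraNneq fpq.
move=> /(congr1 (fun g => sd_coef g (path_triv (path_end p)) q)).
by rewrite sd_coefZ_basis path_comp_trivl eqxx sd_coef0 /= => ->.
Qed.

(** The arrows that leave [x] act by [(a n)(p, q) = n(p a, q)], so the value of
    [n] at a nontrivial path is prescribed by the first arrow of that path. *)
Lemma socle_dual_out_surjective : out_surjective (E : lmodType A).
Proof.
move=> x m em.
pose n : E := sd_make (fun p q =>
  if (val p).2 is a :: s then
    if src a == x then
      oapp (fun p' => sd_coef (m a) p' q) 0
        (insub (tgt a, s) : option (qpath Q))
    else 0
  else 0).
exists n => [|a sa]; apply: sd_coefP => p q spq; rewrite sd_coefZ_basis.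
  rewrite path_comp_trivr; case: eqVneq => //= px; rewrite sd_coef_make spq.
  case: (path_firstP p) => [y ->//|p' a _ sp _ -> _].
  by rewrite -sp eq_sym (negPf px).
case: path_compP => [t pa st et ts|pa] /=.
  rewrite sd_coef_make /sink_pair et [_ && _]spq ts /= sa eqxx.
  have -> : (tgt a, (val p).2) = val p.
    by rewrite -[tgt a]/(path_end (path_arrow a)) -pa [RHS]surjective_pairing.
  by rewrite valK.
rewrite -em // sd_coefZ_basis path_comp_trivr.
by rewrite eq_sym (negPf pa).
Qed.

Lemma socle_dual_injective : injective_module (E : lmodType A).
Proof.
apply: out_surjective_injective => //; first exact: socle_dual_fin_dim.
exact: socle_dual_out_surjective.
Qed.

Lemma sd_embed_envelope : injective_envelope (@sd_embed : {linear A^o -> E}).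
Proof.
split; [exact: socle_dual_injective | exact: sd_embed_inj|].
exact: sd_embed_essential.
Qed.

(** Images take the value zero at [(t, p)] if [t] is longer than [p], and such a
    pair exists as soon as there is an arrow: [p] goes from its target to a
    sink, and [t] is [p] preceded by the arrow. *)
Lemma sd_embed_surjective :
  (forall f : E, exists u, sd_embed u = f) <-> #|arrow Q| = 0%N.
Proof.
split=> [surj|].
  apply/eqP; rewrite -leqn0 leqNgt; apply/negP => /card_gt0P[a _].
  have [p [sp ep]] := path_to_sink (tgt a).
  case tE: (path_comp p (path_arrow a)) => [t|]; last first.
    by move: tE; case: path_compP => //; rewrite sp eqxx.
  have [u uE] := surj (sd_make (fun p' q' => ((p' == t) && (q' == p))%:R)).
  have st : sink_pair t p.
    move: tE; case: path_compP => // t' _ _ et _ [<-].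
    by rewrite /sink_pair et ep eqxx.
  have := congr1 (fun g => sd_coef g t p) uE.
  rewrite sd_coef_embed // sd_coef_make st !eqxx pa_coef_basisM_short.
    by move=> /eqP; rewrite eq_sym oner_eq0.
  by move: tE; case: path_compP => // t' _ _ _ ts [<-]; rewrite ts.
move=> noA f; exists (\sum_(r <- all_paths Q) sd_coef f r r *: path_basis K r).
have triv p : p = path_triv (path_start p).
  case: (path_firstP p) => [x -> //|q a]; have := max_card (pred1 a).
  by rewrite noA card1.
have endE p : path_end p = path_start p by rewrite {1}(triv p).
apply: sd_coefP => p q spq; rewrite sd_coef_embed //.
have qp : q = p.
  rewrite (triv q) (triv p); congr path_triv; rewrite -!endE; apply/eqP.
  by case/andP: spq.
rewrite qp {1}(triv p) [LHS](pa_coef_idemM acQ) (pa_coef_paths acQ) endE.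
by rewrite eqxx mul1r.
Qed.

Section LinearCase.
Hypotheses (connQ : connected Q) (outQ : out_simple Q) (inQ : in_simple Q).

(** The envelope is a sum of copies of the module of all paths from the source,
    one for each [q] that ends at the sink: the path [R x] from the source to
    [x] stands for the indicator function of the path [T x] from [x] to the
    sink.  Both paths are unique, as no two arrows share a source or a
    target. *)
Lemma socle_dual_projective : projective_module (E : lmodType A).
Proof.
have /choice [T TP] := path_to_sink.
have [o /choice [R RP]] : exists o, forall x, exists p : qpath Q,
    path_start p = o /\ path_end p = x.
  have [o oP] := root_walk acQ connQ outQ inQ; exists o => x.
  have [s ws es] := oP x.
  by exists (path_of ws).
have TE p : sink (path_end p) -> p = T (path_start p).
  move=> sp; have [sT eT] := TP (path_start p); apply: path_eq; rewrite ?sT //.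
  apply: (out_simple_walk outQ (valP p)).
  - by have := valP (T (path_start p)); rewrite /= -/(path_start _) sT.
  - exact/forallP.
  - by have /forallP := eT; rewrite /path_end -/(path_start _) sT.
have RE p : path_start p = o -> p = R (path_end p).
  move=> sp; have [sR eR] := RP (path_end p); apply: path_eq; rewrite ?sR //.
  have wp := valP p; rewrite /= -/(path_start p) sp in wp.
  have wR := valP (R (path_end p)); rewrite /= -/(path_start _) sR in wR.
  apply: (in_simple_walk acQ inQ wp wR).
  by move: eR; rewrite /path_end -!/(path_start _) sR sp.
pose phi (q : seq_sub (all_paths Q)) (f : E) : A^o :=
  \sum_x sd_coef f (T x) (val q) *: path_basis K (R x).
have phi_lin j : linear (phi j).
  apply: path_linear => [c f g|r f]; rewrite /phi.
    rewrite scaler_sumr -big_split; apply: eq_bigr => x _ /=.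
    by rewrite sd_coefD sd_coefZ_alg scalerDl -scalerA [_ *: _ in RHS]mulr_algl.
  rewrite (bigD1 (path_end r)) //= big1 ?addr0 => [|x xr]; last first.
    rewrite sd_coefZ_basis; have [sT _] := TP x.
    case: path_compP => [t rT|_]; last by rewrite scale0r.
    by rewrite -rT sT eqxx in xr.
  rewrite scaler_sumr (bigD1 (path_start r)) //=.
  rewrite big1 ?addr0 => [|x xr]; last first.
    rewrite -[_ *: _]scalerAr path_basisM; have [_ eR] := RP x.
    case: path_compP => [t rR|_]; last by rewrite scaler0.
    by rewrite rR eR eqxx in xr.
  rewrite -[RHS]scalerAr path_basisM sd_coefZ_basis.
  have [sT eT] := TP (path_end r); have [sR eR] := RP (path_start r).
  case: path_compP => [t _ st et _|]; last by rewrite sT eqxx.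
  case: path_compP => [v _ sv ev _|]; last by rewrite eR eqxx.
  by rewrite /= {1}(TE t) ?et // st -ev -RE ?sv.
pose phiL j : {linear E -> A^o} :=
  HB.pack (phi j) (GRing.isLinear.Build A E A^o *:%R (phi j) (phi_lin j)).
apply: (@dual_basis_projective K A E _
  (fun q : seq_sub (all_paths Q) =>
     sd_make (fun p q' => ((path_start p == o) && (q' == val q))%:R)) phiL).
  exact: socle_dual_fin_dim.
move=> f; apply: sd_coefP => p q spq.
have qin : q \in all_paths Q by exact: mem_all_paths.
have spT : p = T (path_start p) by apply: TE; case/andP: spq.
have coefb x (q' : seq_sub (all_paths Q)) :
    sd_coef (path_basis K (R x) *:
      sd_make (fun p q => ((path_start p == o) && (q == val q'))%:R)) p q =
    ((path_start p == x) && (q == val q'))%:R.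
  have [sR eR] := RP x; rewrite sd_coefZ_basis.
  case: path_compP => [t pR st et _|]; last by rewrite eR => /negPf ->.
  by rewrite /= sd_coef_make /sink_pair et [_ && _]spq st sR pR eR !eqxx.
have term (q' : seq_sub (all_paths Q)) : sd_coef ((phiL q' f : A) *:
      sd_make (fun p q => ((path_start p == o) && (q == val q'))%:R)) p q =
    if q == val q' then sd_coef f p q else 0.
  rewrite /= /phi scaler_suml sd_coef_sum (bigD1 (path_start p)) //= big1.
    rewrite addr0 scale_algl sd_coefZ_alg coefb eqxx -spT.
    by case: eqP => [->|_]; rewrite ?mulr1 ?mulr0.
  move=> x /negPf px; rewrite scale_algl sd_coefZ_alg coefb eq_sym px.
  by rewrite mulr0.
rewrite sd_coef_sum (bigD1 (SeqSub qin)) //= big1 => [|q' qq']; rewrite term.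
  by rewrite eqxx addr0.
by rewrite -[q]/(val (SeqSub qin)) (inj_eq val_inj) eq_sym (negPf qq').
Qed.

End LinearCase.

End Envelope.

(** * Cokernels of module homomorphisms *)

Section Cokernel.
Local Open Scope quotient_scope.
Variables (R : nzRingType) (N M : lmodType R) (i : {linear N -> M}).

Definition image_pred : {pred M} := fun x => `[< exists n, i n = x >].

Lemma image_zmod_closed : zmod_closed image_pred.
Proof.
split=> [|x y]; first by apply/asboolP; exists 0; rewrite linear0.
move=> /asboolP[n <-] /asboolP[m <-]; apply/asboolP.
by exists (n - m); rewrite linearB.
Qed.

HB.instance Definition _ := GRing.isZmodClosed.Build M
  image_pred image_zmod_closed.

Definition cokernel : Type := Quotient.quot image_pred.

HB.instance Definition _ := GRing.Zmodule.on cokernel.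

Definition coker_proj (x : M) : cokernel := \pi_(Quotient.quot image_pred) x.

Lemma coker_proj_eq x y : coker_proj x = coker_proj y <-> exists n, i n = x - y.
Proof.
have e := Quotient.idealrBE image_pred x y.
split=> [/eqP|xy]; first by rewrite -e => /asboolP.
by apply/eqP; rewrite -e; apply/asboolP.
Qed.

Lemma coker_projD x y : coker_proj (x + y) = coker_proj x + coker_proj y.
Proof. exact: (raddfD \pi_(Quotient.quot image_pred)). Qed.

(** Lifting to an arbitrary representative is harmless by [coker_projZ]. *)
Definition coker_scale (a : R) (c : cokernel) : cokernel :=
  coker_proj (a *: (repr (c : Quotient.quot image_pred))).

Lemma coker_projK (c : cokernel) :
  coker_proj (repr (c : Quotient.quot image_pred)) = c.
Proof. exact: reprK. Qed.

Lemma coker_projZ a x : coker_scale a (coker_proj x) = coker_proj (a *: x).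
Proof.
apply/coker_proj_eq; have /coker_proj_eq[n nE] := coker_projK (coker_proj x).
by exists (a *: n); rewrite linearZ /= nE scalerBr.
Qed.

Lemma coker_scaleA a b c :
  coker_scale a (coker_scale b c) = coker_scale (a * b) c.
Proof. by rewrite -(coker_projK c) !coker_projZ scalerA. Qed.

Lemma coker_scale1 : left_id 1 coker_scale.
Proof. by move=> c; rewrite -(coker_projK c) coker_projZ scale1r. Qed.

Lemma coker_scaleDr : right_distributive coker_scale +%R.
Proof.
move=> a c d; rewrite -(coker_projK c) -(coker_projK d) -coker_projD.
by rewrite !coker_projZ scalerDr coker_projD.
Qed.

Lemma coker_scaleDl c : {morph coker_scale^~ c : a b / a + b}.
Proof.
move=> a b; rewrite -(coker_projK c) !coker_projZ scalerDl.
exact: coker_projD.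
Qed.

HB.instance Definition _ := GRing.Zmodule_isLmodule.Build R cokernel
  coker_scaleA coker_scale1 coker_scaleDr coker_scaleDl.

Lemma coker_proj_linear : linear coker_proj.
Proof. by move=> a x y; rewrite coker_projD -coker_projZ. Qed.

HB.instance Definition _ := GRing.isLinear.Build R M cokernel *:%R coker_proj
  coker_proj_linear.

Lemma coker_proj_surj (c : cokernel) : exists x, coker_proj x = c.
Proof. by exists (repr (c : Quotient.quot image_pred)); exact: coker_projK. Qed.

Lemma coker_proj_eq0 x : coker_proj x = 0 <-> exists n, i n = x.
Proof. by rewrite -(linear0 coker_proj) coker_proj_eq subr0. Qed.

End Cokernel.

Lemma cokernel_exists (R : nzRingType) (N M : lmodType R)
    (i : {linear N -> M}) :
  exists (C : lmodType R) (p : {linear M -> C}),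
    (forall c, exists x, p x = c) /\ forall x, p x = 0 <-> exists n, i n = x.
Proof.
exists (cokernel i), (coker_proj i); split; first exact: coker_proj_surj.
exact: coker_proj_eq0.
Qed.

(** * Dominant dimension of path algebras of acyclic quivers *)

Section DominantDimensionPathAlgebra.
Variables (K : fieldType) (Q : quiver).
Local Notation A := (path_algebra K Q).
Hypotheses (acQ : acyclic Q) (connQ : connected Q).
Local Notation E := (socle_dual K acQ).
Local Notation embed := (@sd_embed K Q acQ : {linear A^o -> E}).

(** This is where [A] being hereditary enters. *)
Lemma out_surjective_quotient (M N : lmodType A) (p : {linear M -> N}) :
  surjective_hom p -> out_surjective M -> out_surjective N.
Proof.
move=> surjp outM x m em; have /choice [n nP] a := surjp (m a).
have [a sa|n' en' n'P] := @outM x (fun a => idem K (tgt a) *: n a).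
  by rewrite scalerA idemM eqxx.
exists (p n') => [|a sa]; first by rewrite -linearZ /= en'.
by rewrite -linearZ /= n'P // linearZ /= nP em.
Qed.

Lemma path_cokernel : exists (C : lmodType A) (p : {linear E -> C}),
  [/\ surjective_hom p, forall x, p x = 0 <-> (exists u, embed u = x)
    & injective_module C].
Proof.
have [C [p [surjp kerp]]] := cokernel_exists embed; exists C, p; split=> //.
apply: out_surjective_injective => //.
  exact: fin_dim_surj surjp (socle_dual_fin_dim K acQ).
by apply: out_surjective_quotient surjp _; exact: socle_dual_out_surjective.
Qed.

Lemma not_simple_dom_dim :
  ~ (out_simple Q /\ in_simple Q) -> dom_dim_alg (A : algType K) = Some 0%N.
Proof.
move=> nsQ; apply: dom_dim_eq0; exists E, embed.
split=> [|projE]; first exact: sd_embed_envelope.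
have inE := projective_in_independent acQ projE.
have outE := @socle_dual_out_surjective K Q acQ.
have injE := @sd_embed_inj K Q acQ.
apply: nsQ; split; first exact: (module_out_simple injE outE inE).
exact: (module_in_simple injE outE inE).
Qed.

Section LinearCase.
Hypotheses (outQ : out_simple Q) (inQ : in_simple Q).

Let projE : projective_module (E : lmodType A).
Proof. exact: socle_dual_projective. Qed.

Let envE := sd_embed_envelope K acQ.

Let envelope_proj : ~ nonprojective_envelope (A^o : lmodType A).
Proof.
case=> I [i [envi []]].
exact: (envelope_projective (regular_fin_dim K acQ) envE envi).
Qed.

Lemma linear_dom_dim :
  (0 < #|arrow Q|)%N -> dom_dim_alg (A : algType K) = Some 1%N.
Proof.
move=> arrQ; have [C [p [surjp kerp injC]]] := path_cokernel.
apply: dom_dim_eqS => // [|ge2].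
  have [R RE] := two_term_resolution envE injC surjp kerp.
  exists R => -[|j] // _; rewrite RE; split=> //.
  exact: socle_dual_injective.
have fdA := regular_fin_dim K acQ.
have projC := two_term_projective envE injC surjp kerp fdA ge2.
have /(sd_embed_surjective K acQ) arr0 :=
  projective_cokernel envE injC surjp kerp projC.
by rewrite arr0 in arrQ.
Qed.

Lemma point_dom_dim :
  #|arrow Q| = 0%N -> dom_dim_alg (A : algType K) = None.
Proof.
move=> /(sd_embed_surjective K acQ) surj.
have [C [p [surjp kerp injC]]] := path_cokernel.
have projC : projective_module C.
  apply: trivial_projective; first by case: injC.
  by move=> c; have [x <-] := surjp c; apply/kerp/surj.
have [R RE] := two_term_resolution envE injC surjp kerp.
apply: dom_dim_eqoo => // n; exists R => -[|[|j]] _; rewrite RE; split=> //.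
- exact: socle_dual_injective.
- apply: trivial_projective; first exact: zero_module_fin_dim.
  exact: zero_module.
- exact: zero_module_injective.
Qed.

End LinearCase.
End DominantDimensionPathAlgebra.

Theorem theorem3p6 (K : fieldType) (Q : quiver) :
  connected Q -> acyclic Q ->
  [/\ forall (n : nat) (n_gt0 : (0 < n)%N), (1 < n)%N ->
        quiver_iso Q (linear_quiver n_gt0) ->
        dom_dim_alg (path_algebra K Q : algType K) = Some 1%N,
      forall n_gt0 : (0 < 1)%N,
        quiver_iso Q (linear_quiver n_gt0) ->
        dom_dim_alg (path_algebra K Q : algType K) = None
    & (forall (n : nat) (n_gt0 : (0 < n)%N),
        ~ quiver_iso Q (linear_quiver n_gt0)) ->
        dom_dim_alg (path_algebra K Q : algType K) = Some 0%N].
Proof.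
move=> connQ acQ; split=> [n n_gt0 n_gt1 isoQ|n_gt0 isoQ|nisoQ].
- have [outQ inQ] := linear_simple isoQ; apply: linear_dom_dim => //.
  by rewrite (linear_arrow isoQ).
- have [outQ inQ] := linear_simple isoQ; apply: point_dom_dim => //.
  by apply/eqP; rewrite -leqn0 leqNgt (linear_arrow isoQ).
- apply: not_simple_dom_dim => // -[outQ inQ].
  by have [n [n_gt0 /nisoQ]] := simple_linear acQ connQ outQ inQ.
Qed.
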